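(* Let $(X,T)$ be any dynamical system such that the entropy map $h:M_T(X)\to\mathbb{R}$ is upper semi-continuous (for the weak-$*$ topology). Let $\mathcal{E}\subset M_{erg}(X)$ be a non-empty collection of ergodic measures such that $\mathcal{E}$ is closed in $M_T(X)$, and suppose that $h$ is constant on $\mathcal{E}$. Then there exists $\phi\in C(X)$ such that for all $\beta\ge 1$, $\overline{co}(\mathcal{E})$ is exactly the collection of all equilibrium states for $\beta\phi$.
   Context: A dynamical system $(X,T)$ consists of a compact metric space $X$ and a continuous action $T=\{T_g\}_{g\in G}$ of a topological (semi)group $G$ on $X$ (continuous maps $T_g:X\to X$ with $T_g\circ T_h=T_{gh}$). $M_T(X)$ is the set of $T$-invariant Borel probability measures on $X$, with the weak-$*$ topology; $M_{erg}(X)\subset M_T(X)$ is the set of ergodic measures. $\overline{co}(\mathcal{E})$ denotes the (weak-$*$) closed convex hull of $\mathcal{E}$. Standing assumptions: $M_T(X)\neq\emptyset$; a measure-theoretic (Kolmogorov-Sinai) entropy $h(\mu)$ is defined for every $\mu\in M_T(X)$ (as is the case when $G$ is amenable), and $h:M_T(X)\to\mathbb{R}$ is non-negative and affine; and the topological entropy $h(X)=\sup\{h(\mu):\mu\in M_T(X)\}$ is finite. $C(X)$ is the space of real-valued continuous functions (potentials) on $X$. The pressure of $\phi\in C(X)$ is $P(\phi)=\sup\{h(\mu)+\int\phi\,d\mu:\mu\in M_T(X)\}$, and $\mu\in M_T(X)$ is an equilibrium state for $\phi$ if $P(\phi)=h(\mu)+\int\phi\,d\mu$. *)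

(* Defs.v *)
From HB Require Import structures.
From mathcomp Require Import all_boot all_order all_algebra.
From mathcomp Require Import all_classical all_reals all_analysis.

Set Implicit Arguments.
Unset Strict Implicit.
Unset Printing Implicit Defensive.

Import Order.TTheory GRing.Theory Num.Theory.
Import numFieldNormedType.Exports.

Local Open Scope classical_set_scope.
Local Open Scope ring_scope.

(* Measurable types are pointed in MathComp-Analysis. A space that carries a
   probability measure is nonempty, so asking for a distinguished point costs
   no generality. *)
#[short(type="pointedMetricType")]
HB.structure Definition PointedMetric (K : numDomainType) :=
  {M of Metric K M & Pointed M}.

HB.mixin Record isTopologicalSemigroup G of Semigroup G & Topological G := {
  mulg_continuous : continuous (fun p : G * G => (p.1 * p.2)%g)
}.

#[short(type="topologicalSemigroupType")]
HB.structure Definition TopologicalSemigroup :=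
  {G of isTopologicalSemigroup G & Semigroup G & Topological G}.

(* Only each T g is required to be continuous: joint continuity on G * X is a
   special case, and amounts to the same thing when G is discrete. *)
Definition continuous_action (G : topologicalSemigroupType)
    (X : topologicalType) (T : G -> X -> X) : Prop :=
  (forall g, continuous (T g)) /\ (forall g h, T g \o T h = T (g * h)%g).

Section borel_probability.
Context {R : realType} (X : pointedMetricType R).

(* A library measure also takes unspecified values on non-Borel sets, so one
   Borel probability has many representatives. This is invisible below: the
   weak-* topology does not separate representatives, hence closed sets are
   saturated for agreement on Borel sets, and semicontinuous real functions,
   as well as affine ones (case t = 1), respect it. *)
Definition borel_probability : Type :=
  probability (g_sigma_algebraType (@open X)) R.

HB.instance Definition _ := Choice.on borel_probability.

Definition integral_functional (mu : borel_probability) :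
    {ptws (continuousType X R) -> R} :=
  fun phi => \int[mu]_x phi x.

(* The weak-* topology: the coarsest one for which integration against each
   continuous function is continuous. *)
HB.instance Definition _ :=
  Topological.copy borel_probability (initial_topology integral_functional).

End borel_probability.

Section dynamical_system.
Context {R : realType} {X : pointedMetricType R}
  {G : topologicalSemigroupType} (T : G -> X -> X).

Definition invariant (mu : borel_probability X) : Prop :=
  forall g (A : set (g_sigma_algebraType (@open X))),
    measurable A -> mu (T g @^-1` A) = mu A.

(* A set_type, hence endowed with the topology induced by the weak-* one. *)
Definition invariant_measure : topologicalType := set_type [set mu | invariant mu].

Definition meas (mu : invariant_measure) : borel_probability X := set_val mu.

(* The sets tested are those invariant modulo mu under every T g: for an
   arbitrary semigroup, this is the notion for which the ergodic measures are
   the extreme points of the set of invariant measures. *)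
Definition ergodic (mu : invariant_measure) : Prop :=
  forall A : set (g_sigma_algebraType (@open X)), measurable A ->
    (forall g, meas mu ((T g @^-1` A `\` A) `|` (A `\` T g @^-1` A)) = 0%E) ->
    meas mu A = 0%E \/ meas mu A = 1%E.

(* rho = t mu + (1 - t) nu as Borel measures. *)
Definition is_mixture (t : R) (mu nu rho : invariant_measure) : Prop :=
  forall A : set (g_sigma_algebraType (@open X)), measurable A ->
    meas rho A = (t%:E * meas mu A + (1 - t)%:E * meas nu A)%E.

Definition convex_measures (C : set invariant_measure) : Prop :=
  forall (t : R) (mu nu rho : invariant_measure), 0 <= t <= 1 ->
    is_mixture t mu nu rho -> C mu -> C nu -> C rho.

Definition closed_convex_hull (E : set invariant_measure) :
    set invariant_measure :=
  smallest [set C | closed C /\ convex_measures C] E.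

Definition affine_map (h : invariant_measure -> R) : Prop :=
  forall (t : R) (mu nu rho : invariant_measure), 0 <= t <= 1 ->
    is_mixture t mu nu rho -> h rho = t * h mu + (1 - t) * h nu.

Definition topological_entropy (h : invariant_measure -> R) : \bar R :=
  ereal_sup [set (h mu)%:E | mu in [set: invariant_measure]].

Definition pressure_functional (h : invariant_measure -> R) (phi : X -> R)
    (mu : invariant_measure) : R :=
  h mu + \int[meas mu]_x phi x.

Definition pressure (h : invariant_measure -> R) (phi : X -> R) : \bar R :=
  ereal_sup [set (pressure_functional h phi mu)%:E | mu in [set: invariant_measure]].

Definition equilibrium_state (h : invariant_measure -> R) (phi : X -> R)
    (mu : invariant_measure) : Prop :=
  pressure h phi = (pressure_functional h phi mu)%:E.

End dynamical_system.

Definition upper_semicontinuous {R : realType} {M : topologicalType}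
    (f : M -> R) : Prop :=
  forall x a, f x < a -> \forall y \near x, f y < a.

(* Main.v *)
Require Import Defs.
From HB Require Import structures.
From mathcomp Require Import all_boot all_order all_algebra.
From mathcomp Require Import all_classical all_reals all_analysis.
From mathcomp Require Import measurable_realfun lra ring.

Set Implicit Arguments.
Unset Strict Implicit.
Unset Printing Implicit Defensive.

Import Order.TTheory GRing.Theory Num.Theory.
Import numFieldNormedType.Exports.

Local Open Scope classical_set_scope.
Local Open Scope ring_scope.

(* The invariant measures form a compact convex set (Riesz representation) in
   which two decompositions of a measure have a common refinement (positive
   parts of invariant functionals are invariant), that is, a simplex, and
   ergodic measures are extreme in it. In a simplex the concave envelope of the
   maximum of two upper semicontinuous affine functions is again upper
   semicontinuous and affine, and it coincides with the maximum at extreme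
   points. Together with a minimax argument this yields Edwards' separation
   theorem in the following form: if [H] is upper semicontinuous, affine and
   nonpositive on a closed set [E] of extreme points, some continuous [f] has
   [\int f dmu >= H mu] for every [mu] and [\int f dmu <= 0] on [E]. The function
   [f] is the limit of approximate solutions; consecutive ones have close
   integrals against invariant measures only, and are made uniformly close by
   adding functions all of whose invariant integrals vanish.

   Let [c] be the value of [h] on [E]. Apply this to the envelope of [h - c],
   [0] and [mu |-> \int g dmu], where [g] runs through a countable family that
   separates the closed convex hull of [E] from every measure outside of it. A
   weighted sum of the resulting functions is [- phi]. For [beta >= 1] the
   integral of [(beta - 1) phi] is nonpositive and vanishes on the hull, so it
   does not change the equilibrium states. *)

(** The three functions under the envelope have separate duties. Dominating [h - c] bounds the
    pressure by [c]; dominating [0] gives the invariant integrals of the result a sign; dominating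
    [g], shifted by a rational so as to be nonpositive on [E], makes the result positive at the
    measures that [g] separates from the hull. In the weighted sum one term of weight 1 already
    dominates [h - c] and [0], and the others have nonnegative integrals, so the domination is
    strict outside the hull. Hahn-Banach separation is replaced throughout by one minimax lemma over
    a compact set of measures or of pairs of measures. Its scalars are rational, so that it also
    applies to the countable set of combinations that indexes the series. Points of the compact set
    are compared through their integrals only, since the weak-* topology does not separate
    representatives of one Borel probability. Inequalities are kept strict as long as possible:
    compactness turns them into uniform gaps, which leave room for the next interpolation. *)

Lemma continuous_maxr (R : realType) (X : topologicalType) (f g : X -> R) :
  continuous f -> continuous g -> continuous (fun x => Num.max (f x) (g x)).
Proof.
move=> cf cg.
rewrite (_ : (fun x => Num.max _ _) =
  (fun x => (f x + g x + `|f x - g x|) / 2)); last first.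
  by apply/funext => y; rewrite maxr_absE.
move=> x; apply: cvgM; last exact: cvg_cst.
apply: cvgD; first by apply: cvgD; [exact: cf|exact: cg].
by apply: cvg_norm; apply: cvgB; [exact: cf|exact: cg].
Qed.

Lemma continuous_minr (R : realType) (X : topologicalType) (f g : X -> R) :
  continuous f -> continuous g -> continuous (fun x => Num.min (f x) (g x)).
Proof.
move=> cf cg.
rewrite (_ : (fun x => Num.min _ _) =
  (fun x => (f x + g x - `|f x - g x|) / 2)); last first.
  by apply/funext => y; rewrite minr_absE.
move=> x; apply: cvgM; last exact: cvg_cst.
apply: cvgB; first by apply: cvgD; [exact: cf|exact: cg].
by apply: cvg_norm; apply: cvgB; [exact: cf|exact: cg].
Qed.

(** * Linear and positive functionals on continuous functions *)

Section functionals.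
Context {R : realType} {X : topologicalType}.
Implicit Types (f g : X -> R) (L S B : (X -> R) -> R).

Definition linear_functional L := forall (s t : R) (f g : X -> R),
  continuous f -> continuous g -> L (s *: f + t *: g) = s * L f + t * L g.

Definition positive_functional L := forall f : X -> R, continuous f ->
  (forall x, 0 <= f x) -> 0 <= L f.

Lemma fcontinuousD f g : continuous f -> continuous g -> continuous (f + g).
Proof. by move=> cf cg a; apply: cvgD; [exact: cf|exact: cg]. Qed.

Lemma fcontinuousB f g : continuous f -> continuous g -> continuous (f - g).
Proof. by move=> cf cg a; apply: cvgB; [exact: cf|exact: cg]. Qed.

Lemma fcontinuousZ (a : R) f : continuous f -> continuous (a *: f).
Proof. by move=> cf b; apply: cvgZr; exact: cf. Qed.

Lemma functionalD L f g : linear_functional L -> continuous f -> continuous g ->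
  L (f + g) = L f + L g.
Proof. by move=> lL cf cg; have := lL 1 1 _ _ cf cg; rewrite !scale1r !mul1r. Qed.

Lemma functionalB L f g : linear_functional L -> continuous f -> continuous g ->
  L (f - g) = L f - L g.
Proof.
by move=> lL cf cg; have := lL 1 (- 1) _ _ cf cg; rewrite scale1r scaleN1r mul1r mulN1r.
Qed.

Lemma functionalZ L (a : R) f : linear_functional L -> continuous f ->
  L (a *: f) = a * L f.
Proof.
by move=> lL cf; have := lL a 0 _ _ cf cf; rewrite scale0r addr0 mul0r addr0.
Qed.

Lemma functional_cst L (c : R) : linear_functional L -> L (cst c) = c * L (cst 1).
Proof.
move=> lL; rewrite -functionalZ//; last exact: cst_continuous.
by congr L; apply/funext => x; exact: esym (mulr1 _).
Qed.

Lemma functional_le L f g : linear_functional L -> positive_functional L ->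
  continuous f -> continuous g -> (forall x, f x <= g x) -> L f <= L g.
Proof.
move=> lL pL cf cg fg; rewrite -subr_ge0 -functionalB//; apply: pL.
  exact: fcontinuousB.
by move=> x; rewrite subr_ge0.
Qed.

End functionals.

(** * Minimax on a compact set *)

(** The filter on lists generated by the supersets of a given list turns near-covering compactness
    into the extraction of a single list valid on all of [A]. *)
Lemma compact_finite_choice (I : eqType) (K : topologicalType) (A : set K)
    (D : set I) (P : I -> K -> Prop) :
  compact A ->
  (forall x, A x -> exists2 i, D i & \forall y \near x, P i y) ->
  exists2 s : seq I, (forall i, i \in s -> D i) &
    forall y, A y -> exists2 i, i \in s & P i y.
Proof.
move=> /compact_near_coveringP cA locP.
pose Q (s : seq I) y := exists2 i, i \in s & D i /\ P i y.
pose F := filter_from [set: seq I]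
  (fun s => [set s' : seq I | {subset s <= s'}]).
have FF : Filter F.
  apply: filter_from_filter; first by exists [::].
  move=> s1 s2 _ _; exists (s1 ++ s2) => // s' /= sub; split=> i si;
    by apply: sub; rewrite mem_cat si ?orbT.
have [|s _ /(_ s) /= sQ] := cA _ F Q FF.
  move=> x Ax; have [i Di Pi] := locP x Ax.
  exists ([set y | P i y], [set s : seq I | i \in s]); first split=> //=.
    by exists [:: i] => // s' /= sub; apply: sub; rewrite inE.
  by move=> [y s] /= [Piy si]; exists i.
have {}sQ : A `<=` Q s by apply: sQ.
exists [seq i <- s | `[< D i >]].
  by move=> i; rewrite mem_filter => /andP[/asboolP].
move=> y /sQ[i si [Di Pi]]; exists i => //.
by rewrite mem_filter si andbT; apply/asboolP.
Qed.

(** If every point were beaten by another one, it would be beaten on a neighbourhood, and finitely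
    many values would beat all of [A], including the largest of them. Semicontinuity is asked within
    [A] only, because of quotients [h / - k] controlled only where [k < 0]. *)
Lemma usc_within_attains_max (R : realType) (K : topologicalType) (A : set K)
    (f : K -> R) :
  compact A -> A !=set0 ->
  (forall x b, A x -> f x < b -> \forall y \near x, A y -> f y < b) ->
  exists2 x, A x & forall y, A y -> f y <= f x.
Proof.
move=> cA [x0 Ax0] uscf; apply: contrapT => nomax.
have [s sA sP] : exists2 s : seq K, (forall i, i \in s -> A i) &
    forall y, A y -> exists2 i, i \in s & A y -> f y < f i.
  apply: compact_finite_choice => // x Ax; apply: contrapT => nx; apply: nomax.
  exists x => // y Ay; rewrite leNgt; apply/negP => xy; apply: nx.
  by exists y => //; exact: uscf.
have smax (s' : seq K) : s' != [::] ->
    exists2 m, m \in s' & forall i, i \in s' -> f i <= f m.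
  elim: s' => // a s' IH _; have [->|/IH[m ms' mmax]] := eqVneq s' [::].
    by exists a; rewrite ?mem_head// => i; rewrite inE => /eqP->.
  have [am|ma] := leP (f a) (f m).
    by exists m => [|i]; rewrite inE ?ms' ?orbT// => /predU1P[->//|/mmax].
  exists a => [|i]; rewrite ?mem_head// inE => /predU1P[->//|/mmax im].
  exact: le_trans im (ltW ma).
have /smax[m ms mmax] : s != [::].
  by apply/eqP => s0; have [i] := sP _ Ax0; rewrite s0.
have [i si /(_ (sA _ ms))] := sP _ (sA _ ms).
by rewrite ltNge mmax.
Qed.

Section minimax.
Context {R : realType}.

(* Any rational [q] between the maximum of [f / - g] on [{f >= 0}] and the
   minimum of [- f / g] on [{g >= 0}] works; concavity separates the two. *)
Lemma usc_pos_combine (K : topologicalType) (A : set K) (f g : K -> R) :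
  compact A ->
  (forall x b, f x < b -> \forall y \near x, f y < b) ->
  (forall x b, g x < b -> \forall y \near x, g y < b) ->
  (forall x y t, A x -> A y -> 0 <= t <= 1 -> exists2 z, A z &
     t * f x + (1 - t) * f y <= f z /\ t * g x + (1 - t) * g y <= g z) ->
  (forall x, A x -> f x < 0 \/ g x < 0) ->
  exists2 q : rat, 0 < q & forall x, A x -> f x + ratr q * g x < 0.
Proof.
move=> cA uf ug cvx neg.
have ulin (c : R) x b : 0 <= c -> f x + c * g x < b ->
    \forall y \near x, f y + c * g y < b.
  move=> c0 fgb; pose e := (b - (f x + c * g x)) / (2 * (1 + c)).
  have e0 : 0 < e by rewrite divr_gt0 ?subr_gt0// mulr_gt0// ltr_wpDr.
  have Ee : (1 + c) * e = (b - (f x + c * g x)) / 2.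
    by rewrite /e; field; rewrite gt_eqF//= ltr_wpDr.
  have fx : f x < f x + e by rewrite ltrDl.
  have gx : g x < g x + e by rewrite ltrDl.
  near=> y.
  have fy : f y < f x + e by near: y; exact: uf.
  have gy : g y < g x + e by near: y; exact: ug.
  have : c * g y <= c * (g x + e) by rewrite ler_wpM2l// ltW.
  move: Ee fgb; lra.
have compactge (h : K -> R) :
    (forall x b, h x < b -> \forall y \near x, h y < b) ->
    compact (A `&` [set x | 0 <= h x]).
  move=> uh; apply: compact_closedI => //.
  rewrite -[X in closed X]setCK; apply: open_closedC.
  rewrite openE => x /= /negP; rewrite -ltNge => hx.
  by apply: filterS (uh _ _ hx) => y hy /=; apply/negP; rewrite -ltNge.
have ulinr (h k : K -> R) : 
    (forall (c : R) x b, 0 <= c -> h x + c * k x < b -> \forall y \near x, h y + c * k y < b) ->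
    (forall x, A x -> 0 <= h x -> k x < 0) ->
    forall x b, (A `&` [set x | 0 <= h x]) x -> h x / - k x < b ->
      \forall y \near x, (A `&` [set x | 0 <= h x]) y -> h y / - k y < b.
  move=> lin kneg x b [Ax /= hx] hkb.
  have kx := kneg _ Ax hx.
  have b0 : 0 < b by apply: le_lt_trans hkb; rewrite divr_ge0// oppr_ge0 ltW.
  have : h x + b * k x < 0.
    by move: hkb; rewrite ltr_pdivrMr ?oppr_gt0// mulrN -subr_lt0 opprK.
  move=> /(lin _ _ _ (ltW b0)); apply: filterS => y hky [Ay /= hy].
  by rewrite ltr_pdivrMr ?oppr_gt0 ?kneg// mulrN -subr_lt0 opprK.
have fneg x : A x -> 0 <= f x -> g x < 0.
  by move=> /neg[]//; rewrite ltNge => /negPf ->.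
have gneg x : A x -> 0 <= g x -> f x < 0.
  by move=> /neg[]// + gx; rewrite ltNge gx.
have ulin' (c : R) x b : 0 <= c -> g x + c * f x < b ->
    \forall y \near x, g y + c * f y < b.
  rewrite le_eqVlt => /predU1P[<-|c0].
    rewrite mul0r addr0 => /ug; apply: filterS => y; by rewrite mul0r addr0.
  move=> gfb; have /ulin : f x + c^-1 * g x < c^-1 * b.
    rewrite -(ltr_pM2l c0) mulrDr !mulVKf ?gt_eqF//; lra.
  rewrite invr_ge0 => /(_ (ltW c0)); apply: filterS => y.
  rewrite -(ltr_pM2l c0) mulrDr !mulVKf ?gt_eqF//; lra.
(* [p] bounds the quotient on [{f >= 0}] and every [q'] between [p] and [q] is admissible on
   [{g >= 0}]. When one of these sets imposes no bound, a convenient value is chosen for it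
   below. *)
have finish (p q : R) : 0 <= p -> (forall x, A x -> 0 <= f x -> f x / - g x <= p) ->
    (forall q', p < q' < q -> forall x, A x -> 0 <= g x -> q' * g x < - f x) -> p < q ->
    exists2 q : rat, 0 < q & forall x, A x -> f x + ratr q * g x < 0.
  move=> p0 hp hq /rat_in_itvoo[r]; rewrite in_itv/= => /andP[pr rq].
  have r0 : 0 < r by rewrite -(ltr0q R) (le_lt_trans p0).
  exists r => // x Ax; have [fx|fx] := ltP (f x) 0; last first.
    have gx := fneg _ Ax fx.
    have := hp _ Ax fx; rewrite ler_pdivrMr ?oppr_gt0// => fpg.
    have : ratr r * g x < p * g x by rewrite ltr_nM2r.
    by move: fpg; lra.
  have [gx|gx] := ltP (g x) 0.
    have : ratr r * g x < 0 by rewrite nmulr_llt0// ltr0q.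
    lra.
  have := hq (ratr r) _ x Ax gx; rewrite pr rq => /(_ isT); lra.
have [Ag0|/set0P Ag] := eqVneq (A `&` [set x | 0 <= g x]) set0.
  have nog x : A x -> 0 <= g x -> False.
    by move=> Ax gx; have : (A `&` [set x | 0 <= g x]) x by []; rewrite Ag0.
  have [Af0|/set0P Af] := eqVneq (A `&` [set x | 0 <= f x]) set0.
    apply: (finish 0 1) => // [x Ax fx|? ? x Ax /nog]; last by case/(_ Ax).
    by have : (A `&` [set x | 0 <= f x]) x by []; rewrite Af0.
  have [x [Ax fx] xmax] := usc_within_attains_max (compactge _ uf) Af
    (ulinr _ _ ulin fneg).
  apply: (finish (f x / - g x) (f x / - g x + 1)).
  - by rewrite divr_ge0// oppr_ge0 ltW// fneg.
  - by move=> y Ay fy; exact: xmax.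
  - by move=> ? ? y Ay /(nog _ Ay).
  - by rewrite ltrDl.
have [y [Ay gy] ymax] := usc_within_attains_max (compactge _ ug) Ag
    (ulinr _ _ ulin' gneg).
have fy := gneg _ Ay gy.
have gbound q' : 0 < q' -> q' * (g y / - f y) < 1 -> forall x, A x -> 0 <= g x -> q' * g x < - f x.
  move=> q0 q1 x Ax gx; have fx := gneg _ Ax gx.
  have := ymax _ (conj Ax gx).
  rewrite ler_pdivrMr ?oppr_gt0// -(ler_pM2l q0) => /le_lt_trans; apply.
  by rewrite mulrA -[ltRHS]mul1r ltr_pM2r ?oppr_gt0.
have [Af0|/set0P Af] := eqVneq (A `&` [set x | 0 <= f x]) set0.
  (* The exact bound is the inverse of [g y / - f y]; adding 1 keeps the inverse meaningful when
     [g y = 0]. *)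
  apply: (finish 0 (1 + g y / - f y)^-1).
  - by [].
  - by move=> x Ax fx; have : (A `&` [set x | 0 <= f x]) x by []; rewrite Af0.
  - move=> q' /andP[q0 qlt]; apply: gbound => //.
    have gf : 0 <= g y / - f y by rewrite divr_ge0// oppr_ge0 ltW.
    have : q' * (1 + g y / - f y) < 1.
      by rewrite -ltr_pdivlMr ?mul1r// ltr_wpDr.
    rewrite mulrDr mulr1; lra.
  - by rewrite invr_gt0 ltr_wpDr// divr_ge0// oppr_ge0 ltW.
have [x [Ax fx] xmax] := usc_within_attains_max (compactge _ uf) Af
    (ulinr _ _ ulin fneg).
have gx := fneg _ Ax fx.
have key : f x / - g x * (g y / - f y) < 1.
  rewrite mulrACA -invfM ltr_pdivrMr; last by rewrite mulr_gt0// oppr_gt0.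
  rewrite mul1r mulrNN; rewrite ltNge; apply/negP => le.
  have d0 : 0 < f x - f y by rewrite subr_gt0 (lt_le_trans fy).
  (* This weight cancels the combination of [f x] and [f y], so [f z >= 0]; if [key] failed,
     [g z >= 0] would hold as well, which [neg] forbids. *)
  have [|z Az [fz gz]] := cvx x y (- f y / (f x - f y)) Ax Ay.
    apply/andP; split; first by rewrite divr_ge0 ?oppr_ge0// ltW.
    by rewrite ler_pdivrMr// mul1r lerDr.
  have E : 1 - - f y / (f x - f y) = f x / (f x - f y).
    by field; rewrite gt_eqF.
  rewrite E in fz gz.
  have f0 : 0 <= f z.
    apply: le_trans fz; rewrite le_eqVlt; apply/orP; left; apply/eqP.
    by field; rewrite gt_eqF.
  have g0 : 0 <= g z.
    apply: le_trans gz.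
    have -> : - f y / (f x - f y) * g x + f x / (f x - f y) * g y =
       (f x * g y - g x * f y) / (f x - f y) by field; rewrite gt_eqF.
    by rewrite divr_ge0 ?(ltW d0)// subr_ge0.
  by have := fneg _ Az f0; rewrite ltNge g0.
have p0 : 0 <= f x / - g x by rewrite divr_ge0// oppr_ge0 ltW.
have [gy0|gy0] := eqVneq (g y) 0.
  apply: (finish (f x / - g x) (f x / - g x + 1)) => //.
  - by move=> ? ? ?; exact: xmax.
  - move=> q' /andP[q0 _]; apply: gbound; first exact: le_lt_trans q0.
    by rewrite gy0 mul0r mulr0.
  - by rewrite ltrDl.
have gf : 0 < g y / - f y by rewrite divr_gt0 ?oppr_gt0// lt0r gy0.
apply: (finish (f x / - g x) (g y / - f y)^-1) => //.
- by move=> ? ? ?; exact: xmax.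
- move=> q' /andP[q0 ql]; apply: gbound; first exact: le_lt_trans q0.
  by rewrite -ltr_pdivlMr// mul1r.
- by rewrite -[ltRHS]mul1r ltr_pdivlMr.
Unshelve. all: by end_near. Qed.


(** At each [k] a multiple of a suitable [u] works, and it still works nearby, so a finite list
    serves all of [A]. Induction on the list merges its members by [usc_pos_combine]. *)
Lemma minimax (V : lmodType R) (W : set V) (K : topologicalType) (A : set K)
    (a : K -> R) (L : K -> V -> R) :
  compact A -> W 0 ->
  (forall (p q : rat) u v, W u -> W v -> W (ratr p *: u + ratr q *: v)) ->
  (forall k (p q : rat) u v, W u -> W v ->
    L k (ratr p *: u + ratr q *: v) = ratr p * L k u + ratr q * L k v) ->
  (forall u, W u -> forall k b, a k + L k u < b ->
    \forall k' \near k, a k' + L k' u < b) ->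
  (forall k1 k2 t, A k1 -> A k2 -> 0 <= t <= 1 -> exists2 k, A k &
    t * a k1 + (1 - t) * a k2 <= a k /\
    forall u, W u -> L k u = t * L k1 u + (1 - t) * L k2 u) ->
  (forall k, A k -> a k < 0 \/ exists2 u, W u & L k u != 0) ->
  exists2 u, W u & forall k, A k -> a k + L k u < 0.
Proof.
move=> cA W0 Wlin Llin usc cvx cond.
have L0 k : L k 0 = 0.
  have := Llin k 0 0 _ _ W0 W0; by rewrite !rmorph0 !scale0r addr0 !mul0r addr0.
have Wscale (p : rat) u : W u -> W (ratr p *: u).
  by move=> Wu; have := Wlin p 0 _ _ Wu W0; rewrite scaler0 addr0.
have Lscale k (p : rat) u : W u -> L k (ratr p *: u) = ratr p * L k u.
  by move=> Wu; have := Llin k p 0 _ _ Wu W0; rewrite scaler0 addr0 L0 mulr0 addr0.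
have cond' k : A k -> exists2 u, W u & a k + L k u < 0.
  move=> /cond[ak|[u Wu Lu]]; first by exists 0 => //; rewrite L0 addr0.
  have [Lneg|Lpos] := ltP (L k u) 0.
    have /rat_in_itvoo[q] : a k / - L k u < a k / - L k u + 1 by rewrite ltrDl.
    rewrite in_itv/= => /andP[+ _]; rewrite ltr_pdivrMr ?oppr_gt0//.
    rewrite mulrN -subr_lt0 opprK => ak.
    by exists (ratr q *: u); [exact: Wscale|rewrite Lscale].
  have {}Lpos : 0 < L k u by rewrite lt0r Lu.
  have /rat_in_itvoo[q] : - a k / L k u - 1 < - a k / L k u by rewrite gtrDl oppr_lt0.
  rewrite in_itv/= => /andP[_]; rewrite ltr_pdivlMr// => ak.
  by exists (ratr q *: u); [exact: Wscale|rewrite Lscale//; lra].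
have [s sW sP] : exists2 s : seq V, (forall u, u \in s -> W u) &
    forall k, A k -> exists2 u, u \in s & a k + L k u < 0.
  apply: (compact_finite_choice (P := fun u k => a k + L k u < 0)) => // k Ak.
  by have [u Wu au] := cond' k Ak; exists u => //; exact: usc.
elim: s A sW sP cA cvx {cond cond'} => [|u s IH] A sW sP cA cvx.
  by exists 0 => // k /sP[].
have Wu : W u by apply: sW; rewrite mem_head.
(* The rest of the list has to deal only with the part of [A] where [u] fails. It is compact by
   semicontinuity and stable under mixtures because [a + L u] is concave, so the induction
   hypothesis applies to it. *)
pose B := A `&` [set k | 0 <= a k + L k u].
have [v Wv vB] : exists2 v, W v & forall k, B k -> a k + L k v < 0.
  apply: IH.
  - by move=> v vs; apply: sW; rewrite inE vs orbT.
  - move=> k [Ak /= ak]; have [v] := sP k Ak.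
    by rewrite inE => /predU1P[->|vs vk]; [rewrite ltNge ak|exists v].
  - apply: compact_closedI => //.
    rewrite -[X in closed X]setCK; apply: open_closedC.
    rewrite openE => k /= /negP; rewrite -ltNge => ak.
    by apply: filterS (usc u Wu _ _ ak) => k' ak' /=; apply/negP; rewrite -ltNge.
  - move=> k1 k2 t [Ak1 /= u1] [Ak2 /= u2] /[dup] t01 /andP[t0 t1].
    have [k Ak [ak Lk]] := cvx k1 k2 t Ak1 Ak2 t01.
    exists k => //; split=> //=; rewrite Lk//.
    have h1 : 0 <= t * (a k1 + L k1 u) by rewrite mulr_ge0.
    have h2 : 0 <= (1 - t) * (a k2 + L k2 u) by rewrite mulr_ge0// subr_ge0.
    by move: ak h1 h2; rewrite !mulrDr; lra.
have [q q0 qP] : exists2 q : rat, 0 < q &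
    forall k, A k -> a k + L k v + ratr q * (a k + L k u) < 0.
  apply: usc_pos_combine => //.
  - by move=> k b; exact: usc.
  - by move=> k b; exact: usc.
  - move=> k1 k2 t Ak1 Ak2 t01.
    have [k Ak [ak Lk]] := cvx k1 k2 t Ak1 Ak2 t01.
    by exists k => //; rewrite !Lk// !mulrDr; split; lra.
  - move=> k Ak; have [uk|uk] := ltP (a k + L k u) 0; first by right.
    by left; apply: vB.
have q1 : 0 < 1 + ratr q :> R by rewrite ltr_pwDl// ler0q ltW.
(* In [a + L v + q (a + L u)] the term [a] has coefficient [1 + q]; dividing by it restores the
   coefficient 1. *)
exists (ratr (1 + q)^-1 *: v + ratr (q / (1 + q)) *: u); first exact: Wlin.
move=> k Ak; rewrite Llin// -(ltr_pM2l q1) mulr0.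
have := qP k Ak; rewrite fmorph_div fmorphV rmorphD rmorph1.
suff -> : (1 + ratr q) * (a k + ((1 + ratr q)^-1 * L k v +
    ratr q / (1 + ratr q) * L k u)) =
  a k + L k v + ratr q * (a k + L k u) :> R by [].
by field; rewrite gt_eqF.
Qed.

End minimax.

(** * Semicontinuous affine functions on a compact set of states *)

Lemma dependent_choice_nat (T : Type) (P : nat -> T -> Prop)
    (Q : nat -> T -> T -> Prop) :
  (exists x, P 0 x) ->
  (forall n x, P n x -> exists2 y, P n.+1 y & Q n x y) ->
  exists u : nat -> T, forall n, P n (u n) /\ Q n (u n) (u n.+1).
Proof.
move=> [x0 Px0] step.
have /choice[g gP] : forall p : nat * T, exists y, P p.1 p.2 -> P p.1.+1 y /\ Q p.1 p.2 y.
  move=> [n x]; have [/step[y Py Qy]|nP] := pselect (P n x); first by exists y.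
  by exists x.
pose u := fix u n := if n is m.+1 then g (m, u m) else x0.
have Pu n : P n (u n) by elim: n => // n IH; have [] := gP (n, u n) IH.
by exists u => n; split => //; have [] := gP (n, u n) (Pu n).
Qed.

Lemma exp2_small (R : realType) (K e : R) : 0 < e -> exists n, K / 2 ^+ n < e.
Proof.
move=> e0; exists (Num.truncn (`|K| / e)).+1.
rewrite ltr_pdivrMr ?exprn_gt0// -ltr_pdivrMl// mulrC.
apply: le_lt_trans (_ : `|K| / e < _); first by rewrite ler_pM2r ?invr_gt0// ler_norm.
apply: lt_trans (truncnS_gt _) _.
by rewrite -natrX ltr_nat ltn_expl.
Qed.

Lemma continuous_geometric_limit (R : realType) (X : topologicalType)
    (C : R) (f : nat -> X -> R) :
  (forall n, continuous (f n)) ->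
  (forall n x, `|f n.+1 x - f n x| <= C / 2 ^+ n) ->
  exists2 g : X -> R, continuous g & forall n x, `|g x - f n x| <= 2 * C / 2 ^+ n.
Proof.
move=> cf df.
have dist n m x : (n <= m)%N -> `|f m x - f n x| <= 2 * C / 2 ^+ n - 2 * C / 2 ^+ m.
  elim: m => [|m IH]; first by rewrite leqn0 => /eqP ->; rewrite !subrr normr0.
  rewrite leq_eqVlt => /predU1P[->|/IH le1]; first by rewrite !subrr normr0.
  have le2 := df m x.
  have E : 2 * C / 2 ^+ m = C / 2 ^+ m + 2 * C / 2 ^+ m.+1.
    by rewrite exprS; field; rewrite expf_neq0.
  have -> : f m.+1 x - f n x = (f m.+1 x - f m x) + (f m x - f n x) by ring.
  by rewrite (le_trans (ler_normD _ _))//; lra.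
have [[x0]|X0] := pselect (exists x : X, True); last first.
  exists (f 0); first exact: cf.
  by move=> n x; exfalso; apply: X0; exists x.
have C0 : 0 <= C by have := df 0%N x0; rewrite expr0 divr1; exact: le_trans.
pose r n : R := 2 * C / 2 ^+ n.
have r0 n : 0 <= r n by rewrite divr_ge0 ?mulr_ge0// exprn_ge0.
have lower n m x : f n x - r n <= f m x + r m.
  have [nm|/ltnW mn] := leqP n m.
    have := dist n m x nm; rewrite ler_norml => /andP[+ _].
    by rewrite -/(r n) -/(r m); have := r0 m; lra.
  have := dist m n x mn; rewrite ler_norml => /andP[_].
  by rewrite -/(r n) -/(r m); have := r0 n; lra.
(* The intervals of centre [f n x] and radius [r n] are nested, [r n] being the geometric bound on
   the remaining increments; the infimum of the upper ends lies in all of them. *)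
pose g x := inf [set f n x + r n | n in [set: nat]].
have gf n x : `|g x - f n x| <= 2 * C / 2 ^+ n.
  have lb m : lbound [set f n x + r n | n in [set: nat]] (f m x - r m).
    by move=> _ [k _ <-].
  rewrite ler_distl; apply/andP; split.
    by apply: lb_le_inf => //; exists (f 0 x + r 0), 0.
  by apply: ge_inf; [exists (f 0 x - r 0)|exists n].
exists g => // x; apply/cvgrPdist_lt => e e0.
have [n ne] : exists n, 2 * C / 2 ^+ n < e / 3 by apply: exp2_small; lra.
have : \forall y \near x, `|f n x - f n y| < e / 3.
  by have /cvgrPdist_lt := cf n x; apply; lra.
apply: filterS => y fxy; have h1 := gf n x; have := gf n y; rewrite distrC => h2.
have -> : g x - g y = (g x - f n x) + (f n x - f n y) + (f n y - g y) by ring.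
rewrite (le_lt_trans (ler_normD _ _))//.
by have := ler_normD (g x - f n x) (f n x - f n y); lra.
Qed.

Lemma upper_semicontinuousD (R : realType) (T : topologicalType) (f g : T -> R) :
  upper_semicontinuous f -> upper_semicontinuous g ->
  upper_semicontinuous (fun x => f x + g x).
Proof.
move=> uf ug x b fgb; pose e := (b - (f x + g x)) / 2.
have fe : f x < f x + e by rewrite /e; lra.
have ge : g x < g x + e by rewrite /e; lra.
near=> y.
have : f y < f x + e by near: y; exact: uf.
have : g y < g x + e by near: y; exact: ug.
by rewrite /e; lra.
Unshelve. all: by end_near. Qed.

Lemma continuous_usc (R : realType) (T : topologicalType) (f : T -> R) :
  continuous f -> upper_semicontinuous f.
Proof. by move=> cf x b fb; exact: (cvgr_lt _ (cf x)). Qed.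

Lemma continuousN_usc (R : realType) (T : topologicalType) (f : T -> R) :
  continuous f -> upper_semicontinuous (fun x => - f x).
Proof. by move=> cf; apply: continuous_usc => x; apply: cvgN; exact: cf. Qed.

Lemma usc_compact_attains (R : realType) (T : topologicalType) (A : set T) (H : T -> R) :
  compact A -> A !=set0 -> upper_semicontinuous H ->
  exists2 x, A x & forall y, A y -> H y <= H x.
Proof.
move=> cA A0 uH; apply: usc_within_attains_max => // x b _ /uH.
by apply: filterS => y.
Qed.

(** * States, mixtures and concave envelopes *)

Section state_relations.
Context {R : realType} {X : topologicalType} {M : Type} (I : M -> (X -> R) -> R).

(** Stands in for equality: [I] is not assumed injective, as distinct points may represent the same
    Borel measure. *)
Definition same_state (x y : M) :=
  forall f : X -> R, continuous f -> I x f = I y f.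

Definition state_mixture (t : R) (x y z : M) := forall f : X -> R, continuous f ->
  I z f = t * I x f + (1 - t) * I y f.

Definition state_affine (H : M -> R) := forall (t : R) (x y z : M), 0 <= t <= 1 ->
  state_mixture t x y z -> H z = t * H x + (1 - t) * H y.

Definition extreme_state (e : M) := forall (s : R) x y, 0 < s < 1 ->
  state_mixture s x y e -> same_state x e /\ same_state y e.

End state_relations.

Section states.
Context {R : realType} {X M : topologicalType} (I : M -> (X -> R) -> R).
Implicit Types (x y z : M) (f g : X -> R) (H : M -> R).

Hypothesis cM : compact [set: M].
Hypothesis I_lin : forall x, linear_functional (I x).
Hypothesis I_cst : forall x c, I x (cst c) = c.
Hypothesis I_cont : forall f, continuous f -> continuous (I ^~ f).

Hypothesis mixture_ex : forall (t : R) x y, 0 <= t <= 1 ->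
  exists z, state_mixture I t x y z.

(** A two by two table of states with masses [a], [b], [c], [d]: its rows give the first
    decomposition, its columns the second. Masses stay unnormalised so that zero entries cause no
    trouble. *)
Hypothesis refinement : forall (s t : R) x y x' y', 0 <= s <= 1 -> 0 <= t <= 1 ->
  (forall f, continuous f ->
    s * I x f + (1 - s) * I y f = t * I x' f + (1 - t) * I y' f) ->
  exists (a b c d : R) m11 m12 m21 m22,
    [/\ 0 <= a, 0 <= b, 0 <= c & 0 <= d] /\
    [/\ a + b = s, c + d = 1 - s, a + c = t & b + d = 1 - t] /\
    forall f, continuous f ->
    [/\ s * I x f = a * I m11 f + b * I m12 f,
        (1 - s) * I y f = c * I m21 f + d * I m22 f,
        t * I x' f = a * I m11 f + c * I m21 f &
        (1 - t) * I y' f = b * I m12 f + d * I m22 f].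

Lemma state_affine_same H x y : state_affine I H -> same_state I x y -> H x = H y.
Proof.
move=> aH xy; rewrite (aH 1 y y x) ?lexx ?ler01//; first by rewrite mul1r subrr mul0r addr0.
by move=> f cf; rewrite mul1r subrr mul0r addr0; exact: xy.
Qed.

(** Homogeneous form of affinity, suited to the masses of [refinement]; when [s = 0], both [a] and
    [b] vanish. *)
Lemma state_affine_scaled H (s a b : R) x y z : state_affine I H -> 0 <= a -> 0 <= b ->
  a + b = s ->
  (forall f, continuous f -> s * I z f = a * I x f + b * I y f) ->
  s * H z = a * H x + b * H y.
Proof.
move=> aH a0 b0 abs E; have [s0|s0] := eqVneq s 0.
  have [-> ->] : a = 0 /\ b = 0 by split; lra.
  by rewrite s0 !mul0r addr0.
have sp : 0 < s by rewrite lt0r s0/=; lra.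
have b1 : 1 - a / s = b / s by rewrite -abs; field; rewrite abs.
rewrite (aH (a / s) x y z) ?b1.
- by field.
- by rewrite divr_ge0 ?(ltW sp)//= ler_pdivrMr// mul1r; lra.
- move=> f cf; apply: (mulfI s0); rewrite E// b1; by field.
Qed.

Lemma mixture_scaled (a b w : R) x y : 0 <= a -> 0 <= b -> a + b = w ->
  exists z, forall f, continuous f -> w * I z f = a * I x f + b * I y f.
Proof.
move=> a0 b0 abw; have [w0|w0] := eqVneq w 0.
  have [-> ->] : a = 0 /\ b = 0 by split; lra.
  by exists x => f _; rewrite w0 !mul0r addr0.
have wp : 0 < w by rewrite lt0r w0/=; lra.
have [|z mz] := @mixture_ex (a / w) x y.
  by rewrite divr_ge0 ?(ltW wp)//= ler_pdivrMr// mul1r; lra.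
exists z => f cf; rewrite mz//.
have -> : 1 - a / w = b / w by rewrite -abw; field; rewrite abw.
by field.
Qed.

Lemma state_affineN H : state_affine I H -> state_affine I (fun x => - H x).
Proof. by move=> aH t x y z t01 xyz; rewrite (aH _ _ _ _ t01 xyz); ring. Qed.

Lemma state_affineB H c : state_affine I H -> state_affine I (fun x => H x - c).
Proof. by move=> aH t x y z t01 xyz; rewrite (aH _ _ _ _ t01 xyz); ring. Qed.

Lemma state_affine_cst c : state_affine I (fun=> c).
Proof. by move=> t x y z _ _; ring. Qed.

Lemma state_affineI f : continuous f -> state_affine I (I ^~ f).
Proof. by move=> cf t x y z _; exact. Qed.

(* The concave envelope of the maximum of [H1] and [H2]: since both are affine,
   mixtures of two states suffice. *)
Definition env_values H1 H2 z : set R := [set v | exists (s : R) x y,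
  [/\ 0 <= s <= 1, state_mixture I s x y z & v = s * H1 x + (1 - s) * H2 y]].

Definition env H1 H2 z := sup (env_values H1 H2 z).

Lemma env_values_has_sup H1 H2 z :
  upper_semicontinuous H1 -> upper_semicontinuous H2 ->
  has_sup (env_values H1 H2 z).
Proof.
move=> u1 u2; split.
  exists (1 * H1 z + (1 - 1) * H2 z), 1, z, z; split => //.
    by rewrite ler01 lexx.
  by move=> f cf; ring.
have T0 : [set: M] !=set0 by exists z.
have [m1 _ max1] := usc_compact_attains cM T0 u1.
have [m2 _ max2] := usc_compact_attains cM T0 u2.
exists (`|H1 m1| + `|H2 m2|) => _ [s [x [y [/andP[s0 s1] _ ->]]]].
have h1 : H1 x <= `|H1 m1| by rewrite (le_trans (max1 x Logic.I))// ler_norm.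
have h2 : H2 y <= `|H2 m2| by rewrite (le_trans (max2 y Logic.I))// ler_norm.
have p1 := ler_wpM2l s0 h1.
have p2 : (1 - s) * H2 y <= (1 - s) * `|H2 m2| by rewrite ler_wpM2l// subr_ge0.
have q1 : s * `|H1 m1| <= `|H1 m1| by rewrite ler_piMl.
have q2 : (1 - s) * `|H2 m2| <= `|H2 m2| by rewrite ler_piMl//; lra.
lra.
Qed.

Section env.
Variables H1 H2 : M -> R.
Hypotheses (u1 : upper_semicontinuous H1) (u2 : upper_semicontinuous H2).
Hypotheses (a1 : state_affine I H1) (a2 : state_affine I H2).

Lemma env_ub s x y z : 0 <= s <= 1 -> state_mixture I s x y z ->
  s * H1 x + (1 - s) * H2 y <= env H1 H2 z.
Proof.
move=> s01 m; apply: ub_le_sup; last by exists s, x, y.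
by have [] := env_values_has_sup z u1 u2.
Qed.

Lemma env_lub z c : (forall s x y, 0 <= s <= 1 -> state_mixture I s x y z ->
  s * H1 x + (1 - s) * H2 y <= c) -> env H1 H2 z <= c.
Proof.
move=> h; apply: ge_sup; first by have [] := env_values_has_sup z u1 u2.
by move=> _ [s [x [y [s01 m ->]]]]; exact: h.
Qed.

Lemma env_ge1 z : H1 z <= env H1 H2 z.
Proof.
rewrite (_ : H1 z = 1 * H1 z + (1 - 1) * H2 z); last by ring.
by apply: env_ub; [rewrite ler01 lexx|move=> f _; ring].
Qed.

Lemma env_ge2 z : H2 z <= env H1 H2 z.
Proof.
rewrite (_ : H2 z = 0 * H1 z + (1 - 0) * H2 z); last by ring.
by apply: env_ub; [rewrite ler01 lexx|move=> f _; ring].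
Qed.

Lemma env_le H : state_affine I H -> (forall x, H1 x <= H x) ->
  (forall x, H2 x <= H x) -> forall z, env H1 H2 z <= H z.
Proof.
move=> aH h1 h2 z; apply: env_lub => s x y /[dup] s01 /andP[s0 s1] m.
rewrite (aH _ _ _ _ s01 m) lerD// ler_wpM2l// ?subr_ge0//.
Qed.

(** Concavity comes from merging near-optimal decompositions of [z1] and [z2]. Convexity is where
    the simplex property enters: a decomposition of [z], refined against [r z1 + (1 - r) z2],
    restricts column by column to decompositions of [z1] and of [z2]. *)
Lemma env_affine : state_affine I (env H1 H2).
Proof.
move=> r z1 z2 z /[dup] r01 /andP[r0 r1] mz; apply/eqP; rewrite eq_le; apply/andP; split.
  apply: env_lub => s x y s01 m.
  have [|a [b [c [d [m11 [m12 [m21 [m22 [[a0 b0 c0 d0] [[ab cd ac bd] E]]]]]]]]]] :=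
      refinement (x := x) (y := y) (x' := z1) (y' := z2) s01 r01.
    by move=> f cf; rewrite -mz// m.
  rewrite (@state_affine_scaled H1 s a b m11 m12)//; last first.
    by move=> f /E[].
  rewrite (@state_affine_scaled H2 (1 - s) c d m21 m22)//; last first.
    by move=> f /E[].
  have sub (p q w : R) u v t' : 0 <= p -> 0 <= q -> p + q = w ->
      (forall f, continuous f -> w * I t' f = p * I u f + q * I v f) ->
      p * H1 u + q * H2 v <= w * env H1 H2 t'.
    move=> p0 q0 pqw Et; have [w0|w0] := eqVneq w 0.
      have [-> ->] : p = 0 /\ q = 0 by split; lra.
      by rewrite w0 !mul0r addr0.
    have wp : 0 < w by rewrite lt0r w0/=; lra.
    have q1 : 1 - p / w = q / w by rewrite -pqw; field; rewrite pqw.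
    have -> : p * H1 u + q * H2 v = w * (p / w * H1 u + (1 - p / w) * H2 v).
      by rewrite q1; field.
    rewrite ler_wpM2l//; first exact: ltW.
    apply: env_ub.
      by rewrite divr_ge0 ?(ltW wp)//= ler_pdivrMr// mul1r; lra.
    by move=> f cf; apply: (mulfI w0); rewrite Et// q1; field.
  have := sub a c r m11 m21 z1 a0 c0 ac (fun f cf => let: And4 _ _ p _ := E f cf in p).
  have := sub b d (1 - r) m12 m22 z2 b0 d0 bd (fun f cf => let: And4 _ _ _ p := E f cf in p).
  lra.
apply/ler_addgt0Pl => e e0.
have [_ [s1 [x1 [y1 [/andP[s10 s11] m1 ->]]]] v1] :=
  sup_adherent e0 (env_values_has_sup z1 u1 u2).
have [_ [s2 [x2 [y2 [/andP[s20 s21] m2 ->]]]] v2] :=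
  sup_adherent e0 (env_values_has_sup z2 u1 u2).
have p1 : 0 <= r * s1 by rewrite mulr_ge0.
have p2 : 0 <= (1 - r) * s2 by rewrite mulr_ge0// subr_ge0.
have p3 : 0 <= r * (1 - s1) by rewrite mulr_ge0// subr_ge0.
have p4 : 0 <= (1 - r) * (1 - s2) by rewrite mulr_ge0// subr_ge0.
have [x mx] := mixture_scaled x1 x2 p1 p2 erefl.
have [y my] := mixture_scaled y1 y2 p3 p4 erefl.
pose s := r * s1 + (1 - r) * s2.
have s'E : r * (1 - s1) + (1 - r) * (1 - s2) = 1 - s by rewrite /s; ring.
have := @env_ub s x y z; rewrite -s'E {1 2 3}/s.
rewrite (state_affine_scaled a1 p1 p2 erefl mx).
rewrite (state_affine_scaled a2 p3 p4 erefl my) => h.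
have {}h : r * s1 * H1 x1 + (1 - r) * s2 * H1 x2 +
  (r * (1 - s1) * H2 y1 + (1 - r) * (1 - s2) * H2 y2) <= env H1 H2 z.
  apply: h; first by rewrite addr_ge0//=; move: s'E p3 p4; rewrite /s; lra.
  move=> f cf; rewrite -s'E mx// my// mz// m1// m2//; ring.
have q1 := ler_wpM2l r0 (ltW v1).
have := ltW v2; rewrite -subr_ge0 => q2.
have q3 : 0 <= (1 - r) * (s2 * H1 x2 + (1 - s2) * H2 y2 - (env H1 H2 z2 - e)).
  by rewrite mulr_ge0// subr_ge0.
move: h q1 q3; rewrite /env; lra.
Qed.

(** The triples [(s, (x, y))] range over a compact set, and the bound by [c] spreads to nearby
    triples and nearby [z'], whence a neighbourhood of [z] that serves all triples. The intermediate
    [c] is there because a supremum of values below [c] is only known to be at most [c]. *)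
Lemma env_usc : upper_semicontinuous (env H1 H2).
Proof.
move=> z b zb; pose c := (env H1 H2 z + b) / 2.
have zc : env H1 H2 z < c by rewrite /c; lra.
have cb : c < b by rewrite /c; lra.
pose K : set (R * (M * M)) := `[0, 1]%classic `*` ([set: M] `*` [set: M]).
have cK : compact K.
  by apply: compact_setX; [exact: segment_compact|exact: compact_setX].
pose P z' (k : R * (M * M)) := 0 <= k.1 <= 1 -> state_mixture I k.1 k.2.1 k.2.2 z' ->
  k.1 * H1 k.2.1 + (1 - k.1) * H2 k.2.2 < c.
have key : \near z, K `<=` P z.
  move/compact_near_coveringP : cK; apply => -[s [x y]] [/= s01 _].
  rewrite in_itv/= in s01.
  have [m|nm] := pselect (state_mixture I s x y z).
    have Wc : s * H1 x + (1 - s) * H2 y < c := le_lt_trans (env_ub s01 m) zc.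
    pose e := (c - (s * H1 x + (1 - s) * H2 y)) / 3.
    have e0 : 0 < e by rewrite /e; lra.
    have x_e : H1 x < H1 x + e by rewrite ltrDl.
    have y_e : H2 y < H2 y + e by rewrite ltrDl.
    have cvgs : (fun k : R * (M * M) => k.1 * H1 x + (1 - k.1) * H2 y) @ (s, (x, y)) -->
        s * H1 x + (1 - s) * H2 y.
      apply: cvgD; apply: cvgM; [exact: cvg_fst|exact: cvg_cst| |exact: cvg_cst].
      by apply: cvgB; [exact: cvg_cst|exact: cvg_fst].
    have c1 : (fun k : R * (M * M) => k.2.1) @ (s, (x, y)) --> x.
      by apply: cvg_comp; [exact: cvg_snd|exact: cvg_fst].
    have c2 : (fun k : R * (M * M) => k.2.2) @ (s, (x, y)) --> y.
      by apply: cvg_comp; [exact: cvg_snd|exact: cvg_snd].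
    have kx : \forall k \near (s, (x, y)), H1 k.2.1 < H1 x + e.
      exact: (c1 _ (u1 x_e)).
    have ky : \forall k \near (s, (x, y)), H2 k.2.2 < H2 y + e.
      exact: (c2 _ (u2 y_e)).
    have ks : \forall k \near (s, (x, y)), k.1 * H1 x + (1 - k.1) * H2 y <
        s * H1 x + (1 - s) * H2 y + e.
      by apply: (cvgr_lt _ cvgs); rewrite ltrDl.
    have kz : \forall k \near (s, (x, y)), forall z', P z' k.
      near=> k => z' /andP[k0 k1] _.
      have nx : H1 k.2.1 < H1 x + e by near: k.
      have ny : H2 k.2.2 < H2 y + e by near: k.
      have ns : k.1 * H1 x + (1 - k.1) * H2 y < s * H1 x + (1 - s) * H2 y + e.
        by near: k.
      have t1 := ler_wpM2l k0 (ltW nx).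
      have t2 : (1 - k.1) * H2 k.2.2 <= (1 - k.1) * (H2 y + e).
        by rewrite ler_wpM2l ?subr_ge0// (ltW ny).
      by move: t1 t2 ns; rewrite /e; lra.
    exists ([set k | forall z', P z' k], [set: M]); first split=> //=.
      exact: filterT.
    by move=> [k z'] /= [].
  (* A triple that does not decompose [z] is refuted by one [f]; by continuity this [f] refutes all
     nearby triples for all nearby [z'], where the bound is then vacuous. *)
  have [f cf ne] : exists2 f, continuous f &
      I z f <> s * I x f + (1 - s) * I y f.
    apply: contrapT => h; apply: nm => f cf; apply: contrapT => ne.
    by apply: h; exists f.
  pose D (p : R * (M * M) * M) :=
    I p.2 f - (p.1.1 * I p.1.2.1 f + (1 - p.1.1) * I p.1.2.2 f).
  have cD : D @ ((s, (x, y)), z) --> D ((s, (x, y)), z).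
    have d1 : (fun p : R * (M * M) * M => p.1.1) @ ((s, (x, y)), z) --> s.
      by apply: cvg_comp; [exact: cvg_fst|exact: cvg_fst].
    have d2 : (fun p : R * (M * M) * M => I p.1.2.1 f) @ ((s, (x, y)), z) --> I x f.
      apply: (@cvg_comp _ _ _ (fun p : R * (M * M) * M => p.1.2.1) (I ^~ f)); last exact: I_cont.
      apply: (@cvg_comp _ _ _ (fun p : R * (M * M) * M => p.1) (fun k : R * (M * M) => k.2.1)).
        exact: cvg_fst.
      by apply: cvg_comp; [exact: cvg_snd|exact: cvg_fst].
    have d3 : (fun p : R * (M * M) * M => I p.1.2.2 f) @ ((s, (x, y)), z) --> I y f.
      apply: (@cvg_comp _ _ _ (fun p : R * (M * M) * M => p.1.2.2) (I ^~ f)); last exact: I_cont.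
      apply: (@cvg_comp _ _ _ (fun p : R * (M * M) * M => p.1) (fun k : R * (M * M) => k.2.2)).
        exact: cvg_fst.
      by apply: cvg_comp; [exact: cvg_snd|exact: cvg_snd].
    have d4 : (fun p : R * (M * M) * M => I p.2 f) @ ((s, (x, y)), z) --> I z f.
      by apply: (@cvg_comp _ _ _ (fun p : R * (M * M) * M => p.2) (I ^~ f)); [exact: cvg_snd|exact: I_cont].
    apply: cvgB => //; apply: cvgD; apply: cvgM => //.
    by apply: cvgB => //; exact: cvg_cst.
  have D0 : D ((s, (x, y)), z) != 0 by rewrite subr_eq0; exact/eqP.
  have : \forall p \near ((s, (x, y)), z), D p != 0.
    by apply: (cvgr_neq0 _ cD).
  apply: filterS => -[k z'] /= Dn _ m; exfalso; move: Dn; rewrite subr_eq0 m//.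
  by rewrite eqxx.
near=> z'.
have Kz' : K `<=` P z' by near: z'.
apply: le_lt_trans cb; apply: env_lub => s x y s01 m.
apply: ltW; apply: (Kz' (s, (x, y))) => //; split.
Unshelve. all: by end_near. Qed.

Lemma env_extreme e c : 
  extreme_state I e ->
  H1 e <= c -> H2 e <= c -> env H1 H2 e <= c.
Proof.
move=> ext h1 h2; apply: env_lub => s x y /[dup] s01 /andP[s0 s1] m.
have [z0|sn0] := eqVneq s 0.
  rewrite z0 mul0r add0r subr0 mul1r -(@state_affine_same H2 e y a2)//.
  by move=> f /m ->; rewrite z0; ring.
have [z0|sn1] := eqVneq s 1.
  rewrite z0 subrr mul0r addr0 mul1r -(@state_affine_same H1 e x a1)//.
  by move=> f /m ->; rewrite z0; ring.
have [|xe ye] := ext s x y _ m; first by rewrite lt0r sn0 s0 lt_neqAle sn1 s1.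
rewrite (state_affine_same a1 xe) (state_affine_same a2 ye).
have p1 := ler_wpM2l s0 h1.
have p2 : (1 - s) * H2 e <= (1 - s) * c by rewrite ler_wpM2l// subr_ge0.
lra.
Qed.

End env.
(** Minimax over pairs [(x, y)] applied to the sum of [H x - I x f] and [N y + I y f]: a pair that
    no [f] separates is a single state, where [H + N < 0] applies. A constant then splits the
    resulting inequality in two. *)
Lemma interpolation (H N : M -> R) (Y : set M) :
  upper_semicontinuous H -> state_affine I H ->
  upper_semicontinuous N -> state_affine I N ->
  compact Y -> Y !=set0 ->
  (forall (t : R) x y, 0 <= t <= 1 -> Y x -> Y y ->
    exists2 z, Y z & state_mixture I t x y z) ->
  (forall y, Y y -> H y + N y < 0) ->
  exists f, [/\ continuous f, forall x, H x < I x f & forall y, Y y -> I y f < - N y].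
Proof.
move=> uH aH uN aN cY [y0 Yy0] Ymix HN.
pose a (k : M * M) := H k.1 + N k.2.
pose L (k : M * M) (f : X -> R) := I k.2 f - I k.1 f.
have usc_fst (Q : M -> R) : upper_semicontinuous Q ->
    upper_semicontinuous (fun k : M * M => Q k.1).
  by move=> uQ k b kb; exact: (cvg_fst (uQ _ _ kb)).
have usc_snd (Q : M -> R) : upper_semicontinuous Q ->
    upper_semicontinuous (fun k : M * M => Q k.2).
  by move=> uQ k b kb; exact: (cvg_snd (uQ _ _ kb)).
have [f cf fP] : exists2 f : X -> R, continuous f &
    forall k, ([set: M] `*` Y) k -> a k + L k f < 0.
  apply: (@minimax R _ [set f : X -> R | continuous f]).
  - exact: compact_setX.
  - exact: cst_continuous.
  - by move=> p q u v cu cv x; apply: cvgD; apply: cvgZr; [exact: cu|exact: cv].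
  - by move=> k p q u v cu cv; rewrite /L !I_lin//; ring.
  - move=> u cu k b.
    have := upper_semicontinuousD
       (usc_fst _ (upper_semicontinuousD uH (continuousN_usc (I_cont cu))))
       (usc_snd _ (upper_semicontinuousD uN (continuous_usc (I_cont cu)))).
    move=> /(_ k b); rewrite /a /L/=.
    have E k' : H k'.1 - I k'.1 u + (N k'.2 + I k'.2 u) =
      H k'.1 + N k'.2 + (I k'.2 u - I k'.1 u) by ring.
    by rewrite E => h /h; apply: filterS => k'; rewrite E.
  - move=> [x1 y1] [x2 y2] t [_ /= Y1] [_ /= Y2] t01.
    have [x mx] := mixture_ex x1 x2 t01.
    have [y Yy my] := Ymix t y1 y2 t01 Y1 Y2.
    exists (x, y) => //; split; last by move=> u cu; rewrite /L/= mx// my//; ring.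
    by rewrite /a/= (aH _ _ _ _ t01 mx) (aN _ _ _ _ t01 my); lra.
  - move=> [x y] [_ /= Yy].
    have [xy|nxy] := pselect (same_state I x y).
      by left; rewrite /a/= (state_affine_same aH xy) HN.
    right; apply: contrapT => h; apply: nxy => u cu; apply: contrapT => ne.
    by apply: h; exists u => //; rewrite /L/= subr_eq0; apply/eqP/nesym.
have [x1 _ x1max] := usc_compact_attains cM (ex_intro [set: M] y0 Logic.I)
  (upper_semicontinuousD uH (continuousN_usc (I_cont cf))).
have [y1 Yy1 y1max] := usc_compact_attains cY (ex_intro Y y0 Yy0)
  (upper_semicontinuousD uN (continuous_usc (I_cont cf))).
(* The maxima of [H - I f] and of [N + I f] have negative sum, so the midpoint between the former
   and the opposite of the latter lies strictly between the two. *)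
pose c := ((H x1 - I x1 f) - (N y1 + I y1 f)) / 2.
have neg := fP (x1, y1) (conj Logic.I Yy1); rewrite /a /L/= in neg.
have Ic x : I x (f + cst c) = I x f + c.
  have -> : f + cst c = 1 *: f + 1 *: cst c by rewrite !scale1r.
  by rewrite I_lin ?mul1r ?I_cst//; exact: cst_continuous.
exists (f + cst c); split.
- by move=> x; apply: cvgD; [exact: cf|exact: cst_continuous].
- by move=> x; have := x1max x Logic.I; rewrite Ic /c; lra.
- by move=> y Yy; have := y1max y Yy; rewrite Ic /c; lra.
Qed.

Lemma separate_above_at H e c : upper_semicontinuous H -> state_affine I H ->
  H e < c -> exists f, [/\ continuous f, forall x, H x < I x f & I e f < c].
Proof.
move=> uH aH Hc; have [||||||f [cf Hf fe]] := @interpolation H (fun=> - c) [set e] uH aH.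
- by apply: continuous_usc; exact: cst_continuous.
- exact: state_affine_cst.
- exact: compact_set1.
- by exists e.
- by move=> t _ _ t01 -> ->; exists e => // f cf; ring.
- by move=> _ ->; rewrite subr_lt0.
- by exists f; split=> //; have := fe e erefl; rewrite opprK.
Qed.

Lemma usc_lt_gap H f : M -> upper_semicontinuous H -> continuous f ->
  (forall x, H x < I x f) -> exists2 e, 0 < e & forall x, H x <= I x f - e.
Proof.
move=> x0 uH cf Hf.
have [x _ xmax] := usc_compact_attains cM (ex_intro [set: M] x0 Logic.I)
  (upper_semicontinuousD uH (continuousN_usc (I_cont cf))).
exists (I x f - H x); first by rewrite subr_gt0.
by move=> y; have := xmax y Logic.I; lra.
Qed.

(** A minimum of two affine functions is not affine in general, but the opposite of the envelope of
    [- I f1] and [- I f2] is, and it lies below both. The uniform gap [e] keeps it strictly above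
    [H]. *)
Lemma interpolate_below2 H f1 f2 :
  upper_semicontinuous H -> state_affine I H ->
  continuous f1 -> continuous f2 ->
  (forall x, H x < I x f1) -> (forall x, H x < I x f2) ->
  exists f, [/\ continuous f, forall x, H x < I x f,
    forall x, I x f < I x f1 & forall x, I x f < I x f2].
Proof.
move=> uH aH cf1 cf2 Hf1 Hf2.
have [[x0]|M0] := pselect (exists x0 : M, True); last first.
  by exists f1; split=> // x; exfalso; apply: M0; exists x.
have [e1 e10 g1] := usc_lt_gap x0 uH cf1 Hf1.
have [e2 e20 g2] := usc_lt_gap x0 uH cf2 Hf2.
pose e := Num.min e1 e2.
have e0 : 0 < e by rewrite lt_min e10.
have u1 := continuousN_usc (I_cont cf1); have u2 := continuousN_usc (I_cont cf2).
have a1 := state_affineN (state_affineI cf1).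
have a2 := state_affineN (state_affineI cf2).
pose N := env (fun x => - I x f1) (fun x => - I x f2).
have Nle x : N x <= - H x - e.
  apply: (env_le u1 u2 (H := fun x => - H x - e)).
  - exact/state_affineB/state_affineN.
  - move=> y; have := g1 y; have : e <= e1 by rewrite ge_min lexx.
    lra.
  - move=> y; have := g2 y; have : e <= e2 by rewrite ge_min lexx orbT.
    lra.
have [||||||f [cf Hf fN]] := @interpolation H N [set: M] uH aH.
- exact: env_usc.
- exact: env_affine.
- exact: cM.
- by exists x0.
- by move=> t x y t01 _ _; have [z] := mixture_ex x y t01; exists z.
- by move=> y _; have := Nle y; lra.
- exists f; split=> // x; have := fN x Logic.I.
    by have := env_ge1 u1 u2 x; rewrite -/N; lra.
  by have := env_ge2 u1 u2 x; rewrite -/N; lra.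
Qed.

(** * From approximate to exact continuous majorants *)

Context {P : topologicalType} (J : P -> (X -> R) -> R).
Hypothesis I_le : forall x f g, continuous f -> continuous g ->
  (forall p, f p <= g p) -> I x f <= I x g.

Hypothesis cP : compact [set: P].
Hypothesis J_lin : forall p : P, linear_functional (J p).
Hypothesis J_cont : forall f, continuous f -> continuous (J ^~ f).
Hypothesis J_dirac : forall a : X, exists p, forall f, continuous f -> J p f = f a.
Hypothesis J_mixture_ex : forall (t : R) p q, 0 <= t <= 1 ->
  exists r, state_mixture J t p q r.
(** In the application [J] ranges over all Borel probabilities and [I] over the invariant ones; [m]
    is the common mass of the positive and negative parts of [p - q]. *)
Hypothesis jordan : forall p q,
  (forall f, continuous f -> (forall x, I x f = 0) -> J p f = J q f) ->
  exists2 m : R, 0 <= m <= 1 & exists x y, forall f, continuous f ->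
    J p f - J q f = m * (I x f - I y f).

Variable x0 : M.

Let I_D x f g : continuous f -> continuous g -> I x (f + g) = I x f + I x g.
Proof. exact: functionalD. Qed.

Let I_B x f g : continuous f -> continuous g -> I x (f - g) = I x f - I x g.
Proof. exact: functionalB. Qed.

(* On pairs of Borel probabilities, minimax produces [u] with zero invariant
   integrals such that [f + u] oscillates by less than [2 * d]: if [p] and [q]
   agree on all such [u], then [p - q] is invariant and so is its Jordan
   decomposition. *)
Lemma uniform_representative (f : X -> R) (d : R) : continuous f ->
  (forall x, `|I x f| < d) ->
  exists2 g : X -> R, continuous g &
    (forall x, I x g = I x f) /\ (forall a, `|g a| <= 3 * d).
Proof.
move=> cf fd.
have J_D p g k : continuous g -> continuous k -> J p (g + k) = J p g + J p k.
  exact: functionalD.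
pose W : set (X -> R) := [set u | continuous u /\ forall x, I x u = 0].
pose a (k : P * P) := J k.1 f - J k.2 f - 2 * d.
pose L (k : P * P) (u : X -> R) := J k.1 u - J k.2 u.
have J_usc u : continuous u ->
    upper_semicontinuous (fun k : P * P => J k.1 u - J k.2 u - 2 * d).
  move=> cu; apply: continuous_usc => k; apply: cvgB; last exact: cvg_cst.
  apply: cvgB.
    by apply: (@cvg_comp _ _ _ fst (J ^~ u)); [exact: cvg_fst|exact: J_cont].
  by apply: (@cvg_comp _ _ _ snd (J ^~ u)); [exact: cvg_snd|exact: J_cont].
have [u [cu u0] uP] : exists2 u, W u &
    forall k, [set: P * P] k -> a k + L k u < 0.
  apply: minimax.
  - by rewrite -setXTT; exact: compact_setX.
  - split; first exact: cst_continuous.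
    by move=> x; exact: I_cst.
  - move=> p q u v [cu u0] [cv v0]; split.
      by move=> b; apply: cvgD; apply: cvgZr; [exact: cu|exact: cv].
    by move=> x; rewrite I_lin// u0 v0 !mulr0 addr0.
  - by move=> k p q u v [cu _] [cv _]; rewrite /L !J_lin//; ring.
  - move=> u [cu _] k b.
    have E k' : a k' + L k' u = J k'.1 (f + u) - J k'.2 (f + u) - 2 * d.
      by rewrite !J_D// /a /L; ring.
    rewrite E => /(J_usc _ (fcontinuousD cf cu)); apply: filterS => k'.
    by rewrite E.
  - move=> [p1 q1] [p2 q2] t _ _ t01.
    have [p mp] := J_mixture_ex p1 p2 t01.
    have [q mq] := J_mixture_ex q1 q2 t01.
    exists (p, q) => //; split; last by move=> u [cu _]; rewrite /L/= mp// mq//; ring.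
    by rewrite /a/= mp// mq//; lra.
  - move=> [p q] _.
    have [pq|npq] := pselect (forall u, W u -> J p u = J q u); last first.
      right; apply: contrapT => h; apply: npq => u cu; apply: contrapT => ne.
      by apply: h; exists u => //; rewrite /L/= subr_eq0; exact/eqP.
    left; have [|m /andP[m0 m1] [x [y E]]] := @jordan p q.
      by move=> g cg g0; exact: pq.
    (* As [m <= 1] and both invariant integrals are below [d] in absolute value,
       [J p f - J q f < 2 * d] holds without any correction. *)
    rewrite /a/= E//.
    have := fd x; rewrite ltr_norml => /andP[_ fx].
    have := fd y; rewrite ltr_norml => /andP[fy _].
    have d0 : 0 < d by apply: le_lt_trans (fd x).
    have : m * (I x f - I y f) <= m * (2 * d) by rewrite ler_wpM2l//; lra.
    have [->|mn0] := eqVneq m 0; first by rewrite mul0r; lra.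
    have : m * (I x f - I y f) < m * (2 * d) by rewrite ltr_pM2l ?lt0r ?mn0//; lra.
    have : m * (2 * d) <= 2 * d by rewrite ler_piMl//; lra.
    lra.
have cfu : continuous (f + u) by exact: fcontinuousD.
have Ifu x : I x (f + u) = I x f by rewrite I_D// u0 addr0.
exists (f + u) => //; split=> // b.
have osc b1 b2 : (f + u) b1 - (f + u) b2 < 2 * d.
  have [p pE] := J_dirac b1; have [q qE] := J_dirac b2.
  have := uP (p, q) Logic.I; rewrite /a /L/= -!pE// -!qE//.
  by rewrite !J_D//; lra.
(* The mean of [f + u] under [x0] is within [d] of 0 and the values are within [2 * d] of that mean,
   hence the constant 3. *)
have := fd x0; rewrite -Ifu ltr_norml => /andP[lo hi].
rewrite ler_norml; apply/andP; split.
  have : I x0 (f + u) <= (f + u) b + 2 * d.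
    rewrite -[leRHS](I_cst x0); apply: I_le => //; first exact: cst_continuous.
    by move=> b'; have := osc b' b; rewrite /cst; lra.
  lra.
have : (f + u) b - 2 * d <= I x0 (f + u).
  rewrite -[leLHS](I_cst x0); apply: I_le => //; first exact: cst_continuous.
  by move=> b'; have := osc b b'; rewrite /cst; lra.
lra.
Qed.

Variable E : set M.
Hypotheses (cE : closed E) (extE : forall e, E e -> extreme_state I e).

(** Each [e] in [E] has a majorant of [H] that is below [d] at [e], hence near [e]. Finitely many of
    them serve all of [E], and repeated interpolation passes below each of them and below [f0]. *)
Lemma interpolate_near_extreme H f0 (d : R) :
  upper_semicontinuous H -> state_affine I H -> (forall e, E e -> H e <= 0) ->
  continuous f0 -> (forall x, H x < I x f0) -> 0 < d ->
  exists f, [/\ continuous f, forall x, H x < I x f,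
    forall x, I x f < I x f0 & forall e, E e -> I e f < d].
Proof.
move=> uH aH HE cf0 Hf0 d0.
have cptE : compact E by exact: subclosed_compact cE cM (@subsetT _ _).
have [s sP cover] : exists2 s : seq (X -> R),
    (forall f, f \in s -> continuous f /\ forall x, H x < I x f) &
    (forall e, E e -> exists2 f, f \in s & I e f < d).
  apply: (compact_finite_choice (P := fun f e => I e f < d)) => // e Ee.
  have [|f [cf Hf fe]] := separate_above_at uH aH
     (c := d) (e := e).
    by rewrite (le_lt_trans (HE _ Ee)).
  by exists f => //; exact: (continuous_usc (I_cont cf)).
have [f [cf Hf ff0 fs]] : exists f, [/\ continuous f, forall x, H x < I x f,
    forall x, I x f < I x f0 & forall g, g \in s -> forall x, I x f < I x g].
  elim: s sP {cover} => [_|g s IH sP].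
    have [f [cf Hf ff0 _]] := interpolate_below2       uH aH cf0 cf0 Hf0 Hf0.
    by exists f.
  have [|f1 [cf1 Hf1 f10 f1s]] := IH.
    by move=> g' g's; apply: sP; rewrite inE g's orbT.
  have [cg Hg] := sP g (mem_head _ _).
  have [f [cf Hf ff1 fg]] := interpolate_below2       uH aH cf1 cg Hf1 Hg.
  exists f; split=> // [x|g']; first exact: lt_trans (ff1 x) _.
  rewrite inE => /predU1P[->//|/f1s g's x]; exact: lt_trans (ff1 x) _.
exists f; split=> // e /cover[g gs]; apply: lt_trans; exact: fs.
Qed.

(** Interpolating above [H] alone would leave the increments unbounded from below. The envelope [Hn]
    also contains [I f - 1 / 2 ^+ n], which confines the invariant integrals of the increment
    between [- 1 / 2 ^+ n] and 0, and it is still nonpositive on [E]. *)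
Lemma majorant_vanishing_on_extreme H :
  upper_semicontinuous H -> state_affine I H -> (forall e, E e -> H e <= 0) ->
  exists f, [/\ continuous f, forall x, H x <= I x f & forall e, E e -> I e f <= 0].
Proof.
move=> uH aH HE.
pose Inv n f := [/\ continuous f, forall x, H x < I x f &
  forall e, E e -> I e f < 1 / 2 ^+ n].
have pow0 n : 0 < 1 / 2 ^+ n :> R by rewrite divr_gt0// exprn_gt0.
have [f fP] : exists f : nat -> X -> R, forall n, Inv n (f n) /\
    (forall a, `|f n.+1 a - f n a| <= 3 / 2 ^+ n).
  apply: (@dependent_choice_nat _ Inv
    (fun n f g => forall a, `|g a - f a| <= 3 / 2 ^+ n)).
    have [m _ mmax] := usc_compact_attains cM (ex_intro [set: M] x0 Logic.I) uH.
    have [|||f [cf Hf _ fE]] := @interpolate_near_extreme H (cst (H m + 1)) 1 uH aH HE.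
    - exact: cst_continuous.
    - by move=> x; rewrite I_cst (le_lt_trans (mmax x Logic.I))// ltrDl.
    - exact: ltr01.
    - by exists f; split=> // e Ee; rewrite expr0 divr1 fE.
  move=> n f [cf Hf fE].
  have uf : upper_semicontinuous (fun x => I x f - 1 / 2 ^+ n).
    apply: continuous_usc => x; apply: cvgB; last exact: cvg_cst.
    exact: I_cont.
  have af : state_affine I (fun x => I x f - 1 / 2 ^+ n).
    by apply: state_affineB; exact: state_affineI.
  pose Hn := env H (fun x => I x f - 1 / 2 ^+ n).
  have [e e0 gap] := usc_lt_gap x0 uH cf Hf.
  pose e' := Num.min e (1 / 2 ^+ n).
  have e'0 : 0 < e' by rewrite lt_min e0 pow0.
  have Hnf x : Hn x < I x f.
    suff : Hn x <= I x f - e' by lra.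
    apply: (env_le uH uf (H := fun x => I x f - e')).
    - by apply: state_affineB; exact: state_affineI.
    - move=> y; have := gap y; have : e' <= e by rewrite ge_min lexx.
      lra.
    - move=> y; have : e' <= 1 / 2 ^+ n by rewrite ge_min lexx orbT.
      lra.
  have [||||||g [cg Hng gf gE]] := @interpolate_near_extreme Hn f (1 / 2 ^+ n.+1) => //.
  - exact: env_usc.
  - exact: env_affine.
  - move=> x Ex; apply: env_extreme => //.
    + exact: extE.
    + exact: HE.
    + by have := fE _ Ex; lra.
  have [||u cu [Iu uB]] := @uniform_representative (g - f) (1 / 2 ^+ n).
  - by move=> x; apply: cvgB; [exact: cg|exact: cf].
  - move=> x; rewrite I_B// ltr_norml; apply/andP; split.
      by have := Hng x; have := env_ge2 uH uf x; rewrite -/Hn; lra.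
    by have := gf x; have := pow0 n; lra.
  have Ifu x : I x (f + u) = I x g by rewrite I_D// Iu I_B//; ring.
  exists (f + u); first split.
  - exact: fcontinuousD.
  - by move=> x; rewrite Ifu (le_lt_trans _ (Hng x))// (env_ge1 uH uf).
  - by move=> x Ex; rewrite Ifu gE.
  - move=> a; have -> : (f + u) a - f a = u a by rewrite /= addrC addKr.
    by have := uB a; rewrite mulrA mulr1.
have [g cg gf] := continuous_geometric_limit
  (fun n => let: And3 p _ _ := (fP n).1 in p) (fun n => (fP n).2).
have Igf x n : `|I x g - I x (f n)| <= 6 / 2 ^+ n.
  have [[cfn _ _] _] := fP n.
  have bd a : `|g a - f n a| <= 6 / 2 ^+ n by have := gf n a; lra.
  rewrite -I_B// ler_norml; apply/andP; split.
    rewrite -[leLHS](I_cst x); apply: I_le => //.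
    + exact: cst_continuous.
    + by move=> a; apply: cvgB; [exact: cg|exact: cfn].
    + by move=> a; have := bd a; rewrite ler_norml => /andP[].
  rewrite -[leRHS](I_cst x); apply: I_le => //.
  + by move=> a; apply: cvgB; [exact: cg|exact: cfn].
  + exact: cst_continuous.
  + by move=> a; have := bd a; rewrite ler_norml => /andP[].
(* On [E] the error is 6 for the distance to [f n] plus 1 for the bound on [I e (f n)], in units of
   [1 / 2 ^+ n]. *)
have small (e : R) : 0 < e -> exists n, 7 / 2 ^+ n < e.
  by exact: exp2_small.
exists g; split=> //.
- move=> x; apply/ler_addgt0Pr => e /small[n ne].
  have [[_ Hf _] _] := fP n; have := Hf x; have := Igf x n.
  rewrite ler_norml => /andP[]; have := pow0 n; lra.
- move=> x Ex; apply/ler_addgt0Pr => e /small[n ne].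
  have [[_ _ fE] _] := fP n; have := fE _ Ex; have := Igf x n.
  rewrite ler_norml => /andP[]; have := pow0 n; lra.
Qed.

(** * A function whose integral vanishes exactly where it should *)

Lemma exposing_function (h : M -> R) (c : R) (F : set M) (K : countType)
    (D : K -> X -> R) :
  compact [set: X] ->
  upper_semicontinuous h -> state_affine I h -> (forall e, E e -> h e = c) ->
  E !=set0 ->
  (forall C : set M, closed C -> forall x y, same_state I x y -> C y -> C x) ->
  closed F -> E `<=` F ->
  (forall (t : R) x y z, 0 <= t <= 1 -> state_mixture I t x y z -> F x -> F y -> F z) ->
  (forall C : set M, closed C ->
    (forall (t : R) x y z, 0 <= t <= 1 -> state_mixture I t x y z -> C x -> C y -> C z) ->
    E `<=` C -> F `<=` C) ->
  (forall i, continuous (D i)) ->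
  (forall x y, (forall i, I x (D i) = I y (D i)) -> same_state I x y) ->
  exists f, [/\ continuous f, forall x, h x - c <= I x f, forall x, 0 <= I x f,
    forall x, F x -> I x f = 0 & forall x, ~ F x -> h x - c < I x f].
Proof.
move=> cX uh ah hE [e0 Ee0] sat cF EF Fcvx Fmin cD Dsep.
(* The index [None] stands for the constant 1, so that combinations can be shifted by a rational. *)
pose D' (i : option K) : X -> R := if i is Some i then D i else cst 1.
pose comb (l : seq (rat * option K)) : X -> R := \sum_(p <- l) ratr p.1 *: D' p.2.
have cD' i : continuous (D' i) by case: i => [i|] //=; exact: cst_continuous.
have ccomb l : continuous (comb l).
  elim: l => [|p l IH]; first by rewrite /comb big_nil; exact: cst_continuous.
  rewrite /comb big_cons; apply: fcontinuousD; [exact: fcontinuousZ|exact: IH].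
have I_Z (a : R) x f : continuous f -> I x (a *: f) = a * I x f.
  exact: functionalZ.
pose H0 := env (fun x => h x - c) (fun=> 0).
have uhc : upper_semicontinuous (fun x => h x - c).
  apply: upper_semicontinuousD => //; apply: continuous_usc; exact: cst_continuous.
have u0 : upper_semicontinuous (fun _ : M => 0 : R).
  by apply: continuous_usc; exact: cst_continuous.
have ahc := state_affineB c ah.
have a0 : state_affine I (fun=> 0) by exact: state_affine_cst.
have uH0 : upper_semicontinuous H0 by exact: env_usc.
have aH0 : state_affine I H0 by exact: env_affine.
have H0E e : E e -> H0 e <= 0.
  move=> Ee; apply: env_extreme => //; first exact: extE.
  by rewrite hE// subrr.
have H0_ge0 x : 0 <= H0 x by exact: (env_ge2 uhc u0 x).
have H0_geh x : h x - c <= H0 x by exact: (env_ge1 uhc u0 x).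
have /choice[psi psiP] : forall l, exists f, [/\ continuous f, forall x, H0 x <= I x f,
    forall e, E e -> I e f <= 0 &
    (forall e, E e -> I e (comb l) <= 0) -> forall x, I x (comb l) <= I x f].
  (* A combination that is positive somewhere on [E] receives a majorant of [H0] alone, so that
     every code has a term in the series. *)
  move=> l; have [neg|npos] := pselect (forall e, E e -> I e (comb l) <= 0); last first.
    have [f [cf Hf fE]] := majorant_vanishing_on_extreme uH0 aH0 H0E.
    by exists f; split.
  have ul := continuous_usc (I_cont (ccomb l)).
  have al : state_affine I (I ^~ (comb l)) by exact: state_affineI.
  have [|||f [cf Hf fE]] := @majorant_vanishing_on_extreme (env H0 (I ^~ (comb l))).
  - exact: env_usc.
  - exact: env_affine.
  - by move=> e Ee; apply: env_extreme => //; [exact: extE|exact: H0E|exact: neg].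
  - exists f; split=> // [x|_ x]; apply: le_trans (Hf x).
      exact: env_ge1.
    exact: (env_ge2 uH0 ul).
pose u n := if unpickle n is Some l then psi l else psi [::].
have uP n : [/\ continuous (u n), forall x, H0 x <= I x (u n) & forall e, E e -> I e (u n) <= 0].
  by rewrite /u; case: unpickle => [l|]; [have [] := psiP l|have [] := psiP [::]].
have /choice[B BP] : forall n, exists b : R, 0 <= b /\ forall a, `|u n a| <= b.
  move=> n; have [cu _ _] := uP n.
  have [[a0']|X0] := pselect (exists a : X, True); last first.
    by exists 0; split=> // a; exfalso; apply: X0; exists a.
  have [a _ amax] := @usc_compact_attains R X setT (fun a => `|u n a|) cX
    (ex_intro [set: X] a0' Logic.I) (continuous_usc (fun a => cvg_norm (cu a))).
  by exists `|u n a|; split=> // a'; exact: amax.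
(* [B n] bounds [u n], so each weighted term is at most [1 / 2 ^+ n] uniformly; adding 1 covers
   [B n = 0]. *)
pose w n : R := (1 + B n)^-1 / 2 ^+ n.
have w0 n : 0 < w n.
  by rewrite divr_gt0 ?exprn_gt0// invr_gt0 ltr_pwDl//; have [] := BP n.
(* [psi [::]] has weight 1 so that it dominates [H0] by itself; the weighted terms only have to
   supply strictness outside [F]. *)
pose S N : X -> R := psi [::] + \sum_(n < N) w n *: u n.
have cS N : continuous (S N).
  elim: N => [|N IH]; first by rewrite /S big_ord0 addr0; have [] := psiP [::].
  rewrite /S big_ord_recr addrA; apply: fcontinuousD; first exact: IH.
  by apply: fcontinuousZ; have [] := uP N.
have SS N : S N.+1 = S N + w N *: u N by rewrite /S big_ord_recr addrA.
have IS x N : I x (S N.+1) = I x (S N) + w N * I x (u N).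
  have [cu _ _] := uP N.
  by rewrite SS I_D ?I_Z//; exact: fcontinuousZ.
have [g cg gS] : exists2 g : X -> R, continuous g &
    forall n a, `|g a - S n a| <= 2 * 1 / 2 ^+ n.
  apply: continuous_geometric_limit => // n a.
  have -> : S n.+1 a - S n a = w n * u n a by rewrite SS /= addrC addKr.
  rewrite normrM (gtr0_norm (w0 n)) /w mulrAC ler_pM2r ?invr_gt0 ?exprn_gt0//.
  have [B0 Bu] := BP n; rewrite ler_pdivrMl ?ltr_pwDl// mulr1.
  by rewrite (le_trans (Bu a))// lerDr.
have IgS x n : `|I x g - I x (S n)| <= 2 / 2 ^+ n.
  have bd a : `|g a - S n a| <= 2 / 2 ^+ n by have := gS n a; rewrite mulr1.
  have cgS : continuous (g - S n) by move=> a; apply: cvgB; [exact: cg|exact: cS].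
  rewrite -I_B// ler_norml; apply/andP; split.
    rewrite -[leLHS](I_cst x); apply: I_le => //; first exact: cst_continuous.
    by move=> a; have := bd a; rewrite ler_norml => /andP[].
  rewrite -[leRHS](I_cst x); apply: I_le => //; first exact: cst_continuous.
  by move=> a; have := bd a; rewrite ler_norml => /andP[].
have u_ge0 x n : 0 <= w n * I x (u n).
  have [_ Hu _] := uP n; rewrite mulr_ge0 ?(ltW (w0 n))//.
  exact: le_trans (H0_ge0 x) (Hu x).
have Smono x n m : (n <= m)%N -> I x (S n) <= I x (S m).
  elim: m => [|m IH]; first by rewrite leqn0 => /eqP ->.
  rewrite leq_eqVlt => /predU1P[->//|/IH]; rewrite IS => h1.
  by have := u_ge0 x m; lra.
have gS_ge x n : I x (S n) <= I x g.
  apply/ler_addgt0Pr => e /(exp2_small 2)[m me].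
  have := Smono x n (maxn n m) (leq_maxl _ _).
  have := IgS x (maxn n m); rewrite ler_norml => /andP[lo _].
  have : 2 / 2 ^+ (maxn n m) <= 2 / 2 ^+ m :> R.
    rewrite ler_pM2l// lef_pV2 ?posrE ?exprn_gt0// ler_weXn2l ?ler1n//.
    exact: leq_maxr.
  by move: lo; lra.
have S0 : S 0%N = psi [::] by rewrite /S big_ord0 addr0.
have g_H0 x : H0 x <= I x g.
  have [_ + _ _] := psiP [::] => /(_ x); rewrite -S0 => /le_trans; apply.
  exact: gS_ge.
have gE e : E e -> I e g <= 0.
  move=> Ee; apply/ler_addgt0Pr => d /(exp2_small 2)[m md].
  have : I e (S m) <= 0.
    elim: m {md} => [|m IH]; first by rewrite S0; have [_ _ + _] := psiP [::]; apply.
    rewrite IS; have [_ _ /(_ _ Ee) ue] := uP m.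
    have : w m * I e (u m) <= 0 by rewrite pmulr_rle0.
    lra.
  have := IgS e m; rewrite ler_norml => /andP[_]; lra.
exists g; split=> //.
- by move=> x; exact: le_trans (H0_geh x) (g_H0 x).
- by move=> x; exact: le_trans (H0_ge0 x) (g_H0 x).
- move=> x Fx; apply/eqP; rewrite eq_le (le_trans (H0_ge0 x))// andbT.
  apply: (Fmin [set x | I x g <= 0]) => //.
    rewrite -[X in closed X]setCK; apply: open_closedC; rewrite openE => y /= /negP.
    rewrite -ltNge => gy; have gz : \forall z \near y, 0 < I z g.
      exact: (cvgr_gt _ (@I_cont _ cg y)).
    by apply: filterS gz => z gz /=; apply/negP; rewrite -ltNge.
  move=> t y1 y2 y /andP[t0 t1] m /= h1 h2; rewrite m//.
  have : t * I y1 g <= 0 by rewrite mulr_ge0_le0.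
  have : (1 - t) * I y2 g <= 0 by rewrite mulr_ge0_le0// subr_ge0.
  lra.
move=> x nFx.
have cptF : compact F by exact: subclosed_compact cF cM (@subsetT _ _).
(* With [a] equal to 0, minimax is the strict separation of [x] from the compact convex set [F], by
   one of countably many combinations. *)
have [_ [l _ <-] lF] : exists2 v, range comb v &
    forall y, F y -> 0 + (I y v - I x v) < 0.
  apply: (@minimax R _ (range comb) M F (fun=> 0) (fun y v => I y v - I x v)) => //.
  - by exists [::]; rewrite // /comb big_nil.
  - move=> p q _ _ [l1 _ <-] [l2 _ <-].
    exists ([seq (p * i.1, i.2) | i <- l1] ++ [seq (q * i.1, i.2) | i <- l2]) => //.
    rewrite /comb big_cat !big_map/= !scaler_sumr.
    by congr (_ + _); apply: eq_bigr => i _; rewrite scalerA rmorphM.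
  - by move=> y p q _ _ [l1 _ <-] [l2 _ <-]; rewrite !I_lin//; ring.
  - move=> _ [l _ <-] y b.
    have cIl : continuous (fun y => 0 + (I y (comb l) - I x (comb l))).
      move=> z; apply: cvgD; first exact: cvg_cst.
      by apply: cvgB; [exact: I_cont|exact: cvg_cst].
    exact: (continuous_usc cIl).
  - move=> y1 y2 t F1 F2 t01; have [y my] := mixture_ex y1 y2 t01.
    exists y; first exact: Fcvx t01 my F1 F2.
    split; first by rewrite !mulr0 addr0.
    by move=> _ [l _ <-]; rewrite my//; ring.
  - move=> y Fy; right; apply: contrapT => hn; apply: nFx.
    apply: (sat _ cF x y) => //; apply: Dsep => i; apply: contrapT => ne.
    apply: hn; exists (comb [:: (1, Some i)]); first by exists [:: (1, Some i)].
    rewrite /comb big_seq1/= rmorph1 scale1r subr_eq0.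
    by apply/eqP; exact: nesym.
have [y1 Fy1 y1max] := usc_compact_attains cptF (ex_intro F e0 (EF _ Ee0))
  (continuous_usc (I_cont (ccomb l))).
have /rat_in_itvoo[q] : I y1 (comb l) < I x (comb l).
  by have := lF _ Fy1; rewrite add0r subr_lt0.
rewrite in_itv/= => /andP[q1 q2].
(* Subtracting [q] makes the combination negative on [F], hence on [E], and positive at [x];
   therefore [psi l'] majorises it and is positive at [x]. *)
pose l' := (- q, None) :: l.
have Il' y : I y (comb l') = I y (comb l) - ratr q.
  rewrite /comb big_cons/= I_D; [|exact/fcontinuousZ/cst_continuous|exact: ccomb].
  by rewrite I_Z ?I_cst ?rmorphN; [ring|exact: cst_continuous].
have [cl Hl El lx] := psiP l'.
have pos : 0 < I x (psi l').
  apply: lt_le_trans (lx _ x); first by rewrite Il' subr_gt0.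
  move=> e Ee; rewrite Il' subr_le0 (le_trans _ (ltW q1))// y1max//.
  exact: EF.
have E1 : u (pickle l') = psi l' by rewrite /u pickleK.
have := gS_ge x (pickle l').+1; rewrite IS E1.
have : 0 < w (pickle l') * I x (psi l') by rewrite mulr_gt0.
have := Smono x 0%N (pickle l') (leq0n _); rewrite S0.
have [_ /(_ x) + _ _] := psiP [::].
have := H0_geh x; lra.
Qed.

End states.

(** * Borel probabilities on a compact metric space *)

Section borel.
Context {R : realType} (X : pointedMetricType R).
Local Notation BX := (g_sigma_algebraType (@open X)).

Lemma mdist_continuous (a : X) : continuous (fun x : X => mdist a x : R).
Proof.
move=> x; apply/cvgrPdist_lt => e e0.
have /= := nbhsx_ballx x _ e0; apply: filterS => y.
rewrite ballEmdist /= => xy.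
have h1 := metric_triangle a x y; have h2 := metric_triangle a y x.
rewrite (metric_sym y x) in h2.
by rewrite ltr_norml; apply/andP; split; lra.
Qed.

Lemma open_measurable_borel (U : set X) : open U -> measurable (U : set BX).
Proof. by move=> oU; exact: sub_sigma_algebra. Qed.

Lemma continuous_measurable_borel (f : X -> R) : continuous f ->
  measurable_fun [set: BX] (f : BX -> R).
Proof.
move=> cf; apply: (measurability _ (measurable_realfun.RGenOpens.measurableE R)).
move=> _ [_ [a [b ->] <-]]; rewrite setTI; apply: open_measurable_borel.
by move/continuousP : cf; apply; exact: interval_open.
Qed.

Lemma compact_continuous_norm_bounded (f : X -> R) : compact [set: X] -> continuous f ->
  exists2 b : R, 0 < b & forall x, `|f x| <= b.
Proof.
move=> cX cf.
have [M [Mr MP]] := @compact_bounded R R (f @` [set: X])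
  (continuous_compact (continuous_subspaceT cf) cX).
exists (`|M| + 1); first by rewrite ltr_wpDl.
by move=> x; apply: (MP (`|M| + 1)) => //; rewrite ltr_pwDr// ler_norm.
Qed.

Lemma continuous_integrable (m : {measure set BX -> \bar R}) (f : X -> R) :
  (m setT < +oo)%E -> compact [set: X] -> continuous f ->
  m.-integrable setT (EFin \o f).
Proof.
move=> mfin cX cf; apply: measurable_bounded_integrable => //.
  exact: continuous_measurable_borel.
have [b b0 bP] := compact_continuous_norm_bounded cX cf.
exists b; split; first exact: num_real.
by move=> c bc x _; exact: le_trans (bP x) (ltW bc).
Qed.

(* [center k] is to list the centers of balls of radius [1 / k.+1] covering [X];
   an index [p.2] beyond its size stands for the junk center [point]. *)
Variable center : nat -> seq X.
Definition net_bump (p : nat * nat) (x : X) : R :=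
  p.1.+1%:R^-1 - mdist (nth point (center p.1) p.2) x.

Definition bump (l : seq (nat * nat)) (x : X) : R :=
  foldr (fun p v => Num.max (net_bump p x) v) 0 l.

Definition sharp_bump (i : seq (nat * nat) * nat) (x : X) : R :=
  Num.min 1 (i.2%:R * bump i.1 x).

Lemma bump_ge0 l x : 0 <= bump l x.
Proof. by elim: l => //= p l IH; rewrite le_max IH orbT. Qed.

Lemma bump_mem l p x : p \in l -> net_bump p x <= bump l x.
Proof.
elim: l => //= q l IH; rewrite inE => /predU1P[->|/IH pl]; rewrite le_max ?lexx//.
by rewrite pl orbT.
Qed.

Lemma bump_le l x v : 0 <= v -> (forall p, p \in l -> net_bump p x <= v) ->
  bump l x <= v.
Proof.
move=> v0; elim: l => //= p l IH h; rewrite ge_max h ?mem_head//= IH// => q ql.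
by rewrite h// inE ql orbT.
Qed.

Lemma sharp_bump_continuous i : continuous (sharp_bump i).
Proof.
apply: continuous_minr; first exact: cst_continuous.
move=> x; apply: cvgM; first exact: cvg_cst.
move: x; case: i => l k /=.
elim: l => /= [|p l IH]; first exact: cst_continuous.
apply: continuous_maxr => // x; apply: cvgB; first exact: cvg_cst.
exact: mdist_continuous.
Qed.

Lemma sharp_bump_ge0 i x : 0 <= sharp_bump i x.
Proof. by rewrite le_min ler01 mulr_ge0// bump_ge0. Qed.

Hypothesis centerP : forall k x, exists2 a, a \in center k & mdist a x < k.+1%:R^-1.

(** Along the net balls contained in [U], with the steepness growing, sharp bumps increase to the
    indicator of [U], and monotone convergence recovers the measure of [U]. *)
Lemma open_eq_of_sharp_bumps (m1 m2 : {measure set BX -> \bar R}) :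
  (forall i, \int[m1]_x (sharp_bump i x)%:E = \int[m2]_x (sharp_bump i x)%:E)%E ->
  forall U : set X, open U -> m1 U = m2 U.
Proof.
move=> E U oU.
pose l N := [seq p <- pmap unpickle (iota 0 N) |
  `[< ball (nth point (center p.1) p.2) (p.1.+1%:R^-1 : R) `<=` U >]].
have lU N p x : p \in l N -> ~ U x -> net_bump p x <= 0.
  rewrite mem_filter => /andP[/asboolP pU _] nUx; rewrite /net_bump subr_le0 leNgt.
  by apply/negP => d; apply: nUx; apply: pU; rewrite ballEmdist.
have bump0 N x : ~ U x -> bump (l N) x = 0.
  move=> nUx; apply/eqP; rewrite eq_le bump_ge0 andbT; apply: bump_le => // p.
  by move=> /lU; exact.
have lmono n m : (n <= m)%N -> {subset l n <= l m}.
  move=> nm p; rewrite !mem_filter => /andP[->] /=; rewrite !mem_pmap.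
  move=> /mapP[k]; rewrite mem_iota => /andP[_ kn] ->; apply: map_f.
  by rewrite mem_iota/= add0n (leq_trans kn).
have lim x : (sharp_bump (l N, N) x)%:E @[N --> \oo] --> (\1_U x)%:E.
  apply: cvg_EFin; first by apply: nearW.
  rewrite indicE; case: (boolP (x \in U)) => [/set_mem Ux|/negP nUx]; last first.
    apply: cvg_near_cst; apply: nearW => N.
    by rewrite /sharp_bump/= bump0 ?mulr0 ?min_r// => Ux; apply: nUx; exact/mem_set.
  have [e /= e0 eU] : exists2 e : R, 0 < e & ball x e `<=` U.
    by apply/nbhs_ballP; exact: open_nbhs_nbhs.
  (* Twice the radius [1 / k.+1] is below [e], so a net ball containing [x] lies in [ball x e],
     hence in [U]. *)
  pose k := Num.truncn (2 / e).
  have ke : k.+1%:R^-1 + k.+1%:R^-1 < e :> R.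
    have := truncnS_gt (2 / e); rewrite -/k => h.
    have k0 : 0 < k.+1%:R :> R by rewrite ltr0n.
    rewrite -(ltr_pM2l k0) mulrDr divff ?gt_eqF//.
    by move: h; rewrite ltr_pdivrMr.
  have [a ak ax] := centerP k x.
  pose p := (k, index a (center k)).
  have pa : nth point (center p.1) p.2 = a by rewrite nth_index.
  have bp : 0 < net_bump p x by rewrite /net_bump pa subr_gt0.
  have pU : ball (nth point (center p.1) p.2) (p.1.+1%:R^-1 : R) `<=` U.
    rewrite pa => y; rewrite ballEmdist/= => ay; apply: eU; rewrite ballEmdist/=.
    apply: le_lt_trans ke; apply: le_trans (metric_triangle x a y) _.
    by rewrite lerD// ltW// metric_sym.
  pose N0 := maxn (pickle p).+1 (Num.truncn (net_bump p x)^-1).+1.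
  apply: cvg_near_cst; near=> N.
  have N0N : (N0 <= N)%N by near: N; exact: nbhs_infty_ge.
  have pl : p \in l N.
    rewrite mem_filter; apply/andP; split; first exact/asboolP.
    rewrite mem_pmap -(@pickleK _ p); apply: map_f; rewrite mem_iota /= add0n.
    by rewrite (leq_trans _ N0N)// leq_max leqnn.
  rewrite /= /sharp_bump/= min_l//.
  apply: le_trans (_ : N%:R * net_bump p x <= _); last first.
    by rewrite ler_wpM2l//; exact: bump_mem.
  rewrite -ler_pdivrMr// mul1r; apply/ltW/(lt_le_trans (truncnS_gt _)).
  by rewrite ler_nat (leq_trans _ N0N)// leq_max leqnn orbT.
have mconv (m : {measure set BX -> \bar R}) :
    m U = limn (fun N => \int[m]_x (sharp_bump (l N, N) x)%:E)%E.
  transitivity (\int[m]_x (\1_U x)%:E)%E.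
    by rewrite integral_indic// ?setIT//; exact: open_measurable_borel.
  rewrite -monotone_convergence//.
  - by apply: eq_integral => x _; apply/esym/cvg_lim.
  - move=> N; apply/measurable_EFinP.
    by apply: continuous_measurable_borel; exact: sharp_bump_continuous.
  - by move=> N x _; rewrite lee_fin sharp_bump_ge0.
  - move=> x _ n k nk; rewrite lee_fin le_min ge_min lexx/= ge_min.
    apply/orP; right; apply: ler_pM => //; first exact: bump_ge0.
      by rewrite ler_nat.
    apply: bump_le; first exact: bump_ge0.
    by move=> p /(lmono _ _ nk); exact: bump_mem.
rewrite !mconv; congr (limn _); apply/funext => N; exact: E.
Unshelve. all: by end_near. Qed.

End borel.

(** Agreement on the bumps of finite nets gives agreement on open sets, a generating class stable
    under intersection. Countability is what lets one convergent series handle all measures outside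
    the hull. *)
Lemma countable_determining_family {R : realType} (X : pointedMetricType R) :
  compact [set: X] ->
  exists D : seq (nat * nat) * nat -> X -> R,
  [/\ forall i, continuous (D i), forall i x, 0 <= D i x &
    forall m1 m2 : {measure set (g_sigma_algebraType (@open X)) -> \bar R},
    (m1 setT < +oo)%E ->
    (forall i, \int[m1]_x (D i x)%:E = \int[m2]_x (D i x)%:E)%E ->
    forall A, measurable A -> m1 A = m2 A].
Proof.
move=> cX.
have /choice[c cP] : forall k : nat, exists s : seq X,
    forall x, exists2 a, a \in s & mdist a x < k.+1%:R^-1 :> R.
  move=> k; have [|s _ sP] := @compact_finite_choice X X setT setT
     (fun a x => mdist a x < k.+1%:R^-1 :> R) cX.
  - move=> x _; exists x => //.
    have k0 : 0 < k.+1%:R^-1 :> R by rewrite invr_gt0 ltr0n.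
    by have /= := nbhsx_ballx x _ k0; apply: filterS => y; rewrite ballEmdist.
  - by exists s => x; exact: (sP x Logic.I).
exists (sharp_bump c); split.
- exact: sharp_bump_continuous.
- exact: sharp_bump_ge0.
move=> m1 m2 m1fin E A mA.
pose BX := g_sigma_algebraType (@open X).
have setIG : setI_closed (@open X : set (set BX)) by move=> U V; exact: openI.
have covG : \bigcup_(k : nat) [set: BX] = setT by rewrite bigcup_const//; exists 0.
apply: (@measure_unique _ R BX (@open X) (fun=> setT) erefl setIG _ covG) => //.
- by move=> _; exact: openT.
- exact: open_eq_of_sharp_bumps E.
Qed.

Section state_of_measure.
Context {R : realType} (X : pointedMetricType R).
Hypothesis cX : compact [set: X].
Implicit Types (mu : borel_probability X) (f g : X -> R).

Lemma borel_probability_integrable mu f : continuous f ->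
  (mu : {measure set _ -> \bar R}).-integrable setT (EFin \o f).
Proof.
move=> cf; apply: continuous_integrable => //.
by change (mu setT < +oo)%E; rewrite probability_setT ltry.
Qed.

Lemma integral_EFin mu f : continuous f ->
  (\int[mu]_x (f x)%:E = (\int[mu]_x f x)%:E)%E.
Proof.
move=> cf; rewrite /Rintegral fineK//.
by apply: integrable_fin_num => //; exact: borel_probability_integrable.
Qed.

Lemma state_lin mu (s t : R) f g : continuous f -> continuous g ->
  \int[mu]_x ((s *: f + t *: g) x) = s * \int[mu]_x f x + t * \int[mu]_x g x.
Proof.
move=> cf cg.
have csf : continuous (fun x => s * f x).
  by move=> x; apply: cvgM; [exact: cvg_cst|exact: cf].
have ctg : continuous (fun x => t * g x).
  by move=> x; apply: cvgM; [exact: cvg_cst|exact: cg].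
rewrite -!RintegralZl//; try exact: borel_probability_integrable.
by rewrite -RintegralD//; exact: borel_probability_integrable.
Qed.

Lemma state_cst mu (c : R) : \int[mu]_x (cst c : X -> R) x = c.
Proof.
have E : mu setT = 1%E by exact: probability_setT.
by rewrite Rintegral_cst// [X in fine X]E mulr1.
Qed.

Lemma state_le mu f g : continuous f -> continuous g -> (forall x, f x <= g x) ->
  \int[mu]_x f x <= \int[mu]_x g x.
Proof.
by move=> cf cg fg; apply: le_Rintegral => //; exact: borel_probability_integrable.
Qed.

End state_of_measure.

(** * The Riesz representation theorem *)

Section riesz.
Context {R : realType} (X : pointedMetricType R) (L : (X -> R) -> R).
Hypothesis cX : compact [set: X].
Hypothesis L_lin : linear_functional L.
Hypothesis L_ge0 : positive_functional L.
Hypothesis L_1 : L (cst 1) = 1.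
Implicit Types (f g : X -> R) (U V : set X).

Let cstX (c : R) : continuous (cst c : X -> R).
Proof. exact: cst_continuous. Qed.

Let L_D f g : continuous f -> continuous g -> L (f + g) = L f + L g.
Proof. exact: functionalD. Qed.

Let L_Z (a : R) f : continuous f -> L (a *: f) = a * L f.
Proof. exact: functionalZ. Qed.

Let L_cst c : L (cst c) = c.
Proof. by rewrite functional_cst// L_1 mulr1. Qed.

Let L_le f g : continuous f -> continuous g -> (forall x, f x <= g x) -> L f <= L g.
Proof. exact: functional_le. Qed.

Let cont_sum N (F : nat -> X -> R) : (forall n, continuous (F n)) ->
  continuous (\sum_(n < N) F n).
Proof.
move=> cF; elim: N => [|N IH]; first by rewrite big_ord0; exact: cstX.
by rewrite big_ord_recr; exact: fcontinuousD.
Qed.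

Let L_sum N (F : nat -> X -> R) : (forall n, continuous (F n)) ->
  L (\sum_(n < N) F n) = \sum_(n < N) L (F n).
Proof.
move=> cF; elim: N => [|N IH]; first by rewrite !big_ord0; exact: L_cst.
by rewrite !big_ord_recr/= L_D ?IH//; exact: cont_sum.
Qed.

(** Vanishing off [U] replaces the customary compact support in [U]; the difference is absorbed by
    the constant [e] of [L_countable_cover]. *)
Definition unit_below U : set (X -> R) := [set f : X -> R | [/\ continuous f,
  forall x, 0 <= f x <= 1 & forall x, ~ U x -> f x = 0]].

Definition inner U : R := sup (L @` unit_below U).

Lemma unit_below0 U : unit_below U (cst 0).
Proof. by split=> // x; rewrite /cst lexx ler01. Qed.

Lemma L_unit_below U f : unit_below U f -> 0 <= L f <= 1.
Proof.
move=> [cf f01 _]; apply/andP; split.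
  by apply: L_ge0 => // x; have /andP[] := f01 x.
by rewrite -L_1; apply: L_le => // x; have /andP[] := f01 x.
Qed.

Lemma inner_has_sup U : has_sup (L @` unit_below U).
Proof.
split; first by exists (L (cst 0)), (cst 0) => //; exact: unit_below0.
by exists 1 => _ [f /L_unit_below/andP[_ f1] <-].
Qed.

Lemma inner_ub U f : unit_below U f -> L f <= inner U.
Proof.
by move=> Uf; apply: ub_le_sup; [have [] := inner_has_sup U|exists f].
Qed.

Lemma inner_ge0 U : 0 <= inner U.
Proof. by rewrite -(L_cst 0); apply: inner_ub; exact: unit_below0. Qed.

Lemma inner_le U (c : R) : (forall f, unit_below U f -> L f <= c) -> inner U <= c.
Proof.
move=> h; apply: ge_sup; first by have [] := inner_has_sup U.
by move=> _ [f /h fc <-].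
Qed.

Lemma inner_le1 U : inner U <= 1.
Proof. by apply: inner_le => f /L_unit_below/andP[]. Qed.

Lemma le_inner U V : U `<=` V -> inner U <= inner V.
Proof.
move=> UV; apply: inner_le => f [cf f01 f0]; apply: inner_ub; split=> // x nVx.
by apply: f0 => /UV.
Qed.

Definition outer (A : set X) : R := inf (inner @` [set U | open U /\ A `<=` U]).

Lemma outer_has_inf A : has_inf (inner @` [set U | open U /\ A `<=` U]).
Proof.
split; first by exists (inner setT), setT => //; split=> //; exact: openT.
by exists 0 => _ [U _ <-]; exact: inner_ge0.
Qed.

Lemma outer_lb A U : open U -> A `<=` U -> outer A <= inner U.
Proof.
by move=> oU AU; apply: ge_inf; [have [] := outer_has_inf A|exists U].
Qed.

Lemma outer_ge A (c : R) : (forall U, open U -> A `<=` U -> c <= inner U) ->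
  c <= outer A.
Proof.
move=> h; apply: lb_le_inf; first by have [] := outer_has_inf A.
by move=> _ [U [oU AU] <-]; exact: h.
Qed.

Lemma outer_ge0' A : 0 <= outer A.
Proof. by apply: outer_ge => U _ _; exact: inner_ge0. Qed.

Lemma le_outer A B : A `<=` B -> outer A <= outer B.
Proof.
by move=> AB; apply: outer_ge => U oU BU; apply: outer_lb => //; exact: subset_trans BU.
Qed.

Lemma outer_open U : open U -> outer U = inner U.
Proof.
move=> oU; apply/eqP; rewrite eq_le outer_lb//=.
by apply: outer_ge => V _; exact: le_inner.
Qed.

Lemma outerT : outer setT = 1.
Proof.
rewrite outer_open; last exact: openT.
apply/eqP; rewrite eq_le inner_le1 -L_1 inner_ub//.
split; [exact: cstX|by move=> x; rewrite /cst lexx ler01|by move=> x []].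
Qed.

Lemma outer_set0 : outer set0 = 0.
Proof.
apply/eqP; rewrite eq_le outer_ge0' andbT.
apply: (le_trans (outer_lb open0 (@subset_refl _ _))).
apply: inner_le => f [cf _ f0]; rewrite -(L_cst 0); apply: L_le => // x.
by rewrite f0.
Qed.

Lemma bump_at U x : open U -> U x ->
  exists2 g, unit_below U g & g x = 1.
Proof.
move=> oU Ux; have [r /= r0 rU] : exists2 e : R, 0 < e & ball x e `<=` U.
  by apply/nbhs_ballP; exact: open_nbhs_nbhs.
exists (fun y => Num.max 0 (1 - mdist x y / r)); last first.
  by rewrite mdistxx mul0r subr0 max_r.
split.
- apply: continuous_maxr; first exact: cstX.
  move=> y; apply: cvgB; first exact: cvg_cst.
  by apply: cvgM; [exact: mdist_continuous|exact: cvg_cst].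
- move=> y; rewrite le_max lexx/= ge_max ler01/=.
  have : 0 <= mdist x y / r by rewrite divr_ge0 ?mdist_ge0// ltW.
  lra.
- move=> y nUy; rewrite max_l// subr_le0 ler_pdivlMr// mul1r leNgt.
  by apply/negP => xy; apply: nUy; apply: rU; rewrite ballEmdist.
Qed.

(** Where [f < e] the constant dominates [f]; on the compact rest, finitely many bumps, grouped by
    the open set they belong to, add up to at least 1. *)
Lemma L_countable_cover (U : nat -> set X) f (e : R) :
  (forall n, open (U n)) -> unit_below (\bigcup_n U n) f -> 0 < e ->
  exists N, L f <= e + \sum_(n < N) inner (U n).
Proof.
move=> oU [cf f01 f0] e0.
pose K := [set x | e <= f x].
have cK : compact K.
  apply: (subclosed_compact _ cX) => //.
  rewrite -[X in closed X]setCK; apply: open_closedC; rewrite openE => y /= /negP.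
  rewrite -ltNge => fy.
  have fye : \forall z \near y, f z < e by exact: (cvgr_lt _ (cf y)).
  by apply: filterS fye => z fz /=; apply/negP; rewrite -ltNge.
have [s sP cover] : exists2 s : seq (nat * (X -> R)),
    (forall p, p \in s -> unit_below (U p.1) p.2) &
    (forall y, K y -> exists2 p, p \in s & 2^-1 < p.2 y).
  apply: (compact_finite_choice (P := fun p y => 2^-1 < p.2 y)
    (D := [set p | unit_below (U p.1) p.2])) => // x Kx.
  have [n _ Un] : (\bigcup_n U n) x.
    have [[n _ Un]|nU] := pselect ((\bigcup_n U n) x); first by exists n.
    by move: Kx; rewrite /K/= f0// leNgt e0.
  have [g Ug gx] := bump_at (oU n) Un.
  exists (n, g) => //=; have [cg _ _] := Ug.
  by apply: (cvgr_gt _ (cg x)); rewrite gx; lra.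
(* A selected bump exceeds 1/2 where it is used, so doubling and cutting at 1 gives the value 1
   there. Bumps of the same index are combined by a maximum, since a sum could exceed 1. *)
pose G n y := foldr (fun (p : nat * (X -> R)) v => if p.1 == n then
  Num.max (Num.min 1 (2 * p.2 y)) v else v) 0 s.
have GU n : unit_below (U n) (G n).
  rewrite /G; elim: s sP {cover G} => [_|p s IH sP] /=; first exact: unit_below0.
  have {}IH := IH (fun q qs => sP q (mem_behead (s := p :: s) qs)).
  have [pn|//] := eqVneq p.1 n.
  have [cp p01 p0] := sP p (mem_head _ _); have [cr r01 r0] := IH.
  split.
  - apply: continuous_maxr => //; apply: continuous_minr; first exact: cstX.
    by move=> x; apply: cvgM; [exact: cvg_cst|exact: cp].
  - move=> x; have /andP[r0x r1x] := r01 x.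
    by rewrite le_max r0x orbT/= ge_max ge_min lexx.
  - move=> x nUx; rewrite r0// p0 ?pn// mulr0 min_r// maxxx//.
have G_ge0 n y : 0 <= G n y by have [_ /(_ y)/andP[]] := GU n.
pose N := (\max_(p <- s) p.1).+1.
exists N; have contG n : continuous (G n) by have [] := GU n.
apply: (@le_trans _ _ (L (cst e + \sum_(n < N) G n))); last first.
  rewrite L_D//; last exact: cont_sum.
  rewrite L_cst L_sum// lerD2l ler_sum// => n _; exact: inner_ub.
apply: L_le => //; first by apply: fcontinuousD => //; exact: cont_sum.
move=> y; change (f y <= e + (\sum_(n < N) G n) y); rewrite fct_sumE.
have [fy|fy] := ltP (f y) e.
  by rewrite (le_trans (ltW fy))// lerDl sumr_ge0.
have [p ps py] := cover y fy.
have pN : (p.1 < N)%N by rewrite ltnS (big_rem p)//= leq_maxl.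
have /andP[_ f1] := f01 y.
apply: (le_trans f1); rewrite (bigD1 (Ordinal pN))//=.
have : 1 <= G p.1 y.
  rewrite /G; elim: s ps {sP cover G GU G_ge0 N contG pN} => //= q s IH.
  rewrite inE => /predU1P[<-|/IH h].
    by rewrite eqxx le_max le_min lexx/=; apply/orP; left; lra.
  by case: eqP => // _; rewrite le_max h orbT.
have : 0 <= \sum_(i < N | i != Ordinal pN) G i y by rewrite sumr_ge0.
lra.
Qed.

Lemma inner_bigcup (U : nat -> set X) : (forall n, open (U n)) ->
  ((inner (\bigcup_n U n))%:E <= \sum_(n <oo) (inner (U n))%:E)%E.
Proof.
move=> oU; apply/lee_addgt0Pr => e e0.
have [f Uf fe] : exists2 f, unit_below (\bigcup_n U n) f &
    inner (\bigcup_n U n) - e / 2 < L f.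
  have [_ [f Uf <-] fe] := sup_adherent (divr_gt0 e0 (ltr0n _ 2)) (inner_has_sup (\bigcup_n U n)).
  by exists f.
have [N fN] := L_countable_cover oU Uf (divr_gt0 e0 (ltr0n _ 2)).
apply: (@le_trans _ _ ((\sum_(n < N) inner (U n))%:E + e%:E)%E).
  by rewrite -EFinD lee_fin; lra.
rewrite leeD2r// -sumEFin -(big_mkord xpredT (fun n => (inner (U n))%:E)).
by apply: nneseries_lim_ge => n _ _; rewrite lee_fin inner_ge0.
Qed.

Let outerE (A : set X) : \bar R := (outer A)%:E.

Lemma outer_sigma_subadditive : sigma_subadditive outerE.
Proof.
move=> F; apply/lee_addgt0Pr => e e0.
apply: le_trans (epsilon_trick xpredT (fun n => _) (ltW e0)); last first.
  by move=> n; rewrite lee_fin outer_ge0'.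
have /choice[U UP] : forall n, exists U, [/\ open U, F n `<=` U &
    inner U <= outer (F n) + e / (2 ^ n.+1)%:R].
  move=> n; have en : 0 < e / (2 ^ n.+1)%:R by rewrite divr_gt0// ltr0n expn_gt0.
  have [_ [U [oU FU] <-] Ue] := inf_adherent en (outer_has_inf (F n)).
  by exists U; split=> //; exact: ltW.
apply: (@le_trans _ _ (inner (\bigcup_n U n))%:E).
  rewrite lee_fin; apply: outer_lb.
    by apply: bigcup_open => n _; have [] := UP n.
  by apply: subset_bigcup => n _; have [] := UP n.
apply: le_trans (inner_bigcup _) _; first by move=> n; have [] := UP n.
apply: lee_nneseries => [n _ _|n _]; first by rewrite lee_fin inner_ge0.
by have [_ _ h] := UP n; rewrite /outerE -EFinD lee_fin.
Qed.

(** Where a near-optimal [f] is at least [e], a near-optimal [g] for [V] vanishes; thus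
    [f + g <= 1 + e], and the rescaled sum competes for [W]. Two errors [e] come from the suprema
    and one from the rescaling, hence [d / 3]. *)
Lemma inner_split U W : open U -> open W ->
  inner (W `&` U) + outer (W `&` ~` U) <= inner W.
Proof.
move=> oU oW; apply/ler_addgt0Pr => d d0; pose e := d / 3.
have e0 : 0 < e by rewrite /e; lra.
have [_ [f [cf f01 f0] <-] fe] := sup_adherent e0 (inner_has_sup (W `&` U)).
pose V := W `&` [set x | f x < e].
have oV : open V.
  apply: openI => //; rewrite openE => y /= fy.
  exact: (cvgr_lt _ (cf y)).
have WV : W `&` ~` U `<=` V.
  by move=> x [Wx nUx]; split=> //=; rewrite f0// => -[].
have [_ [g [cg g01 g0] <-] ge] := sup_adherent e0 (inner_has_sup V).
have oV' := outer_lb oV WV.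
have k0 : 0 < 1 + e by lra.
have below : unit_below W ((1 + e)^-1 *: (f + g)).
  split; first exact/fcontinuousZ/fcontinuousD.
  - move=> x; change (0 <= (1 + e)^-1 * (f x + g x) <= 1); have /andP[f0x f1x] := f01 x.
    have /andP[g0x g1x] := g01 x.
    rewrite mulr_ge0 ?invr_ge0 ?(ltW k0) ?addr_ge0//= ler_pdivrMl// mulr1.
    have [fx|fx] := ltP (f x) e; first by rewrite addrC lerD// ltW.
    by rewrite g0 ?addr0 ?(le_trans f1x) ?lerDl ?(ltW e0)// => -[_] /=; rewrite ltNge fx.
  - move=> x nWx; change ((1 + e)^-1 * (f x + g x) = 0); rewrite f0; last by move=> [].
    by rewrite g0 ?addr0 ?mulr0// => -[].
have := inner_ub below; rewrite L_Z ?L_D//; last exact: fcontinuousD.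
rewrite ler_pdivrMl// => h.
have : e * inner W <= e by rewrite ler_piMr ?(ltW e0)// inner_le1.
move: fe ge h; rewrite /e/inner/=; rewrite -/(inner _) -/(inner _) -/(inner _); lra.
Qed.

Lemma open_caratheodory U : open U -> forall A,
  ((outer (A `&` U))%:E + (outer (A `&` ~` U))%:E <= (outer A)%:E)%E.
Proof.
move=> oU A; rewrite -EFinD lee_fin; apply: outer_ge => W oW AW.
apply: le_trans (inner_split oU oW); apply: lerD.
  by apply: outer_lb; [exact: openI|exact: setSI].
by apply: le_outer; exact: setSI.
Qed.

(** Cuts [t] into slices of height 1: [clamp (t - k%:R)] is a continuous substitute for the
    indicator of [k%:R < t]. *)
Let clamp (t : R) : R := Num.max 0 (Num.min 1 t).

Let sum_clamp (t : R) n : 0 <= t -> \sum_(k < n) clamp (t - k%:R) = Num.min t n%:R.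
Proof.
move=> t0; elim: n => [|n IH]; first by rewrite big_ord0 min_r.
rewrite big_ord_recr/= IH /clamp -natr1.
case: (leP t n%:R) => tn.
  by rewrite max_l ?ge_min ?subr_le0 ?tn ?orbT// addr0 min_l//; lra.
have tn0 : 0 <= t - n%:R by lra.
case: (leP 1 (t - n%:R)) => h.
  by rewrite max_r// min_r//; lra.
by rewrite max_r// min_l; lra.
Qed.

Let sum_indic (t : R) n : 0 <= t -> \sum_(k < n) (nat_of_bool (k%:R < t)%R)%:R <= t + 1.
Proof.
move=> t0; suff : \sum_(k < n) (nat_of_bool (k%:R < t)%R)%:R <= Num.min (t + 1) n%:R.
  by rewrite le_min => /andP[].
elim: n => [|n IH]; first by rewrite big_ord0 le_min lexx andbT; lra.
rewrite big_ord_recr/= -natr1 le_min; move: IH; rewrite le_min => /andP[h1 h2].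
by case: ltP => tn; rewrite /= ?mulr1n ?mulr0n ?addr0; apply/andP; split; lra.
Qed.

(** The measure is the Caratheodory restriction of [outer] to Borel sets. Only [L f <= \int f] needs
    proof, as the same inequality for [- f] gives equality. *)
Theorem riesz_representation : exists mu : borel_probability X,
  forall f, continuous f -> \int[mu]_x f x = L f.
Proof.
pose BX := g_sigma_algebraType (@open X).
pose om : {outer_measure set X -> \bar R} := HB.pack (outerE : set X -> \bar R)
  (isOuterMeasure.Build R X outerE (congr1 EFin outer_set0)
  (fun A => outer_ge0' A) le_outer outer_sigma_subadditive).
have caraE (A : set BX) : measurable A -> om.-cara.-measurable A.
  move: A; apply: smallest_sub; first exact: (@sigma_algebra_measurable _ (caratheodory_type om)).
  move=> U oU; apply: le_caratheodory_measurable => B; exact: open_caratheodory.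
pose m (A : set BX) : \bar R := (outer A)%:E.
have m0 : m set0 = 0%E by rewrite /m outer_set0.
have m_ge0 A : (0 <= m A)%E by rewrite lee_fin outer_ge0'.
have msa : semi_sigma_additive m.
  move=> F mF tF mUF; apply: (@caratheodory_measure_sigma_additive R X om F) => //.
    by move=> n; apply: caraE.
  exact: caraE.
pose mm := isMeasure.Build _ _ _ m m0 m_ge0 msa.
pose m' : {measure set BX -> \bar R} := HB.pack m mm.
have m1 : m' setT = 1%E by rewrite /= /m outerT.
pose mu : borel_probability X := HB.pack m mm (Measure_isProbability.Build _ _ _ m' m1).
have muU U : open U -> mu U = (inner U)%:E by move=> oU; rewrite -outer_open.
(* Layers of [N f]: the value of [L] on slice [k] is at most the mass of [U k], and these masses add
   up to at most the integral of [N f + 1]. Dividing by [N] leaves an error [1 / N]. *)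
have le01 f : continuous f -> (forall x, 0 <= f x <= 1) -> L f <= \int[mu]_x f x.
  move=> cf f01; apply/ler_addgt0Pr => e e0.
  have [n ne] : exists n : nat, e^-1 < n.+1%:R.
    by exists (Num.truncn e^-1); exact: truncnS_gt.
  pose N := n.+1; have N0 : 0 < N%:R :> R by rewrite ltr0n.
  pose F k : X -> R := fun x => clamp (N%:R * f x - k%:R).
  pose U k : set X := [set x | k%:R < N%:R * f x].
  have cNf : continuous (fun x => N%:R * f x).
    by move=> x; apply: cvgM; [exact: cvg_cst|exact: cf].
  have cF k : continuous (F k).
    apply: continuous_maxr; first exact: cstX.
    apply: continuous_minr; first exact: cstX.
    by move=> x; apply: cvgB; [exact: cNf|exact: cvg_cst].
  have oU k : open (U k).
    rewrite openE => x /= kx; exact: (cvgr_gt _ (cNf x)).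
  have FU k : unit_below (U k) (F k).
    split=> // x.
      by rewrite /F /clamp le_max lexx/= ge_max ge_min lexx ler01.
    move=> /negP; rewrite -leNgt => h; rewrite /F /clamp max_l//.
    by rewrite ge_min subr_le0 h orbT.
  have NLf : N%:R * L f = \sum_(k < N) L (F k).
    rewrite -L_sum// -L_Z//; congr L; apply/funext => x.
    rewrite fct_sumE /F sum_clamp.
      rewrite min_l//; have /andP[_ fx] := f01 x.
      by rewrite ler_piMr// ltW.
    by rewrite mulr_ge0// ?(ltW N0)//; have /andP[] := f01 x.
  have cNf1 : continuous (fun x => N%:R * f x + 1).
    by move=> x; apply: cvgD; [exact: cNf|exact: cvg_cst].
  have sumU : ((\sum_(k < N) inner (U k))%:E <= \int[mu]_x (N%:R * f x + 1)%:E)%E.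
    rewrite -sumEFin.
    rewrite (eq_bigr (fun k : 'I_N => \int[mu]_x (\1_(U k) x)%:E)%E); last first.
      move=> k _; rewrite integral_indic// ?setIT -?muU//.
      by apply: open_measurable_borel.
    have mU k : measurable (U k : set BX) by exact: open_measurable_borel.
    rewrite -ge0_integral_sum//; last first.
      by move=> k; apply/measurable_EFinP; exact: measurable_indic.
    apply: ge0_le_integral => //.
    - by move=> x _; apply: sume_ge0 => k _; rewrite lee_fin.
    - apply: emeasurable_sum => k; apply/measurable_EFinP; exact: measurable_indic.
    - by apply/measurable_EFinP; exact: continuous_measurable_borel.
    - move=> x _; rewrite sumEFin lee_fin.
      have fx : 0 <= N%:R * f x.
        by rewrite mulr_ge0// ?(ltW N0)//; have /andP[] := f01 x.
      apply: le_trans (sum_indic N fx); apply: ler_sum => k _.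
      rewrite indicE; case: (boolP (x \in U k)) => [/set_mem/= ->//|_].
      by rewrite ler0n.
  have lin : \int[mu]_x (N%:R * f x + 1) = N%:R * \int[mu]_x f x + 1.
    rewrite -[X in _ + X](state_cst mu 1) -[X in _ + X]mul1r -(state_lin cX)//.
    by apply: eq_Rintegral => x _; rewrite scale1r.
  move: sumU; rewrite integral_EFin// lee_fin lin => sumU.
  have : N%:R * L f <= N%:R * \int[mu]_x f x + 1.
    rewrite NLf; apply: le_trans sumU; apply: ler_sum => k _; exact: inner_ub.
  have Ne : 1 <= N%:R * e by rewrite -ler_pdivrMr// mul1r ltW.
  move=> h; rewrite -(ler_pM2l N0) mulrDr; lra.
have le f : continuous f -> L f <= \int[mu]_x f x.
  move=> cf; have [b b0 fb] := compact_continuous_norm_bounded cX cf.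
  (* [c f + 1 / 2] takes its values in [[0, 1]], and the inequality to be proved is unaffected by
     this rescaling. *)
  pose c := (2 * b)^-1; have c0 : 0 < c by rewrite invr_gt0 mulr_gt0.
  have cb : c * b = 1 / 2 by rewrite /c; field; rewrite gt_eqF.
  have c1 : continuous (cst 1 : X -> R) by exact: cstX.
  have := le01 (c *: f + (1 / 2) *: cst 1).
  rewrite (state_lin cX)// L_lin// state_cst L_1 lerD2r ler_pM2l//; apply.
    by apply: fcontinuousD; exact: fcontinuousZ.
  move=> x; change (0 <= c * f x + 1 / 2 * 1 <= 1).
  have := fb x; rewrite ler_norml => /andP[h1 h2].
  have := ler_wpM2l (ltW c0) h1; have := ler_wpM2l (ltW c0) h2.
  by rewrite mulrN cb => *; apply/andP; split; lra.
exists mu => f cf; apply/eqP; rewrite eq_le le// andbT.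
have := le (- 1 *: f + 0 *: f).
rewrite (state_lin cX)// L_lin// !mul0r !addr0 !mulN1r lerN2; apply.
by apply: fcontinuousD; exact: fcontinuousZ.
Qed.

End riesz.

(** * The positive part of a linear functional *)

Section positive_part.
Context {R : realType} {X : topologicalType}.
Implicit Types (f g : X -> R) (B : (X -> R) -> R).
Variables (S B0 : (X -> R) -> R).
Hypotheses (lS : linear_functional S) (lB0 : linear_functional B0).
Hypothesis pB0 : positive_functional B0.
Hypothesis SB0 : forall f : X -> R, continuous f -> (forall x, 0 <= f x) -> S f <= B0 f.

(* The Riesz-Kantorovich formula for the positive part of [S]. *)
Let below f := [set g : X -> R | continuous g /\ forall x, 0 <= g x <= f x].
Let Sp f := sup (S @` below f).

Let below0 f : (forall x, 0 <= f x) -> below f (cst 0).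
Proof. by move=> f0; split; [exact: cst_continuous|move=> x; rewrite lexx f0]. Qed.

Let below_ub B f g : linear_functional B -> positive_functional B ->
  (forall f : X -> R, continuous f -> (forall x, 0 <= f x) -> S f <= B f) ->
  continuous f -> below f g -> S g <= B f.
Proof.
move=> lB pB SB cf [cg gf]; apply: (@le_trans _ _ (B g)).
  by apply: SB => // x; have /andP[] := gf x.
by apply: functional_le => // x; have /andP[] := gf x.
Qed.

Let Sp_has_sup f : continuous f -> (forall x, 0 <= f x) -> has_sup (S @` below f).
Proof.
move=> cf f0; split; first by exists (S (cst 0)), (cst 0) => //; exact: below0.
by exists (B0 f) => _ [g fg <-]; exact: below_ub.
Qed.

Let Sp_ub f g : continuous f -> below f g -> S g <= Sp f.
Proof.
move=> cf fg; apply: ub_le_sup; last by exists g.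
have [_ h] := fg; have f0 x : 0 <= f x.
  by have /andP[] := h x; exact: le_trans.
by have [] := Sp_has_sup cf f0.
Qed.

Let Sp_le f (c : R) : (forall x, 0 <= f x) -> (forall g, below f g -> S g <= c) ->
  Sp f <= c.
Proof.
move=> f0 h; apply: ge_sup; last by move=> _ [g fg <-]; exact: h.
by exists (S (cst 0)), (cst 0) => //; exact: below0.
Qed.

Let SpD f g : continuous f -> continuous g -> (forall x, 0 <= f x) ->
  (forall x, 0 <= g x) -> Sp (f + g) = Sp f + Sp g.
Proof.
move=> cf cg f0 g0; have cfg := fcontinuousD cf cg.
have fg0 x : 0 <= (f + g) x by rewrite addr_ge0.
apply/eqP; rewrite eq_le; apply/andP; split.
  apply: Sp_le => // u [cu ufg].
  (* Cutting [u] at [f] leaves a remainder between 0 and [g]: the Riesz decomposition property of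
     continuous functions. *)
  pose v x := Num.min (u x) (f x).
  have cv : continuous v by exact: continuous_minr.
  have -> : u = v + (u - v) by rewrite addrC subrK.
  rewrite functionalD//; last exact: fcontinuousB.
  have u0 x : 0 <= u x by have /andP[] := ufg x.
  apply: lerD; apply: Sp_ub => //; split=> //.
  - by move=> x; rewrite le_min u0 f0/= ge_min lexx orbT.
  - exact: fcontinuousB.
  - move=> x; change (0 <= u x - v x <= g x).
    have h : u x <= f x + g x by have /andP[] := ufg x.
    have := g0 x; rewrite /v.
    by case: (leP (u x) (f x)) => ? ?; apply/andP; split; lra.
apply/ler_addgt0Pr => e e0; have e20 : 0 < e / 2 by lra.
have [_ [u [cu uf] <-] ue] := sup_adherent e20 (Sp_has_sup cf f0).
have [_ [v [cv vg] <-] ve] := sup_adherent e20 (Sp_has_sup cg g0).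
have := @Sp_ub (f + g) (u + v) cfg; rewrite functionalD// => h.
have {}h : S u + S v <= Sp (f + g).
  apply: h; split; first exact: fcontinuousD.
  move=> x; change (0 <= u x + v x <= f x + g x).
  have /andP[a1 a2] := uf x; have /andP[b1 b2] := vg x.
  by rewrite addr_ge0//= lerD.
by move: ue ve; rewrite -/(Sp f) -/(Sp g); lra.
Qed.

Let SpZ f (a : R) : continuous f -> (forall x, 0 <= f x) -> 0 <= a ->
  Sp (a *: f) = a * Sp f.
Proof.
have half (b : R) (k : X -> R) : continuous k -> (forall x, 0 <= k x) -> 0 < b ->
    b * Sp k <= Sp (b *: k).
  move=> ck k0 b0; rewrite -ler_pdivlMl//; apply: Sp_le => // g [cg gk].
  rewrite ler_pdivlMl// -functionalZ//; apply: Sp_ub; first exact: fcontinuousZ.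
  split; first exact: fcontinuousZ.
  move=> x; change (0 <= b * g x <= b * k x); have /andP[h1 h2] := gk x.
  by rewrite mulr_ge0 ?(ltW b0)//= ler_pM2l.
move=> cf f0; rewrite le_eqVlt => /predU1P[<-|a0].
  rewrite scale0r mul0r; apply/eqP; rewrite eq_le; apply/andP; split.
    apply: Sp_le => // g [cg g0].
    have -> : g = cst 0.
      by apply/funext => x; apply/eqP; rewrite eq_le andbC; exact: g0.
    by rewrite functional_cst// mul0r.
  rewrite -[leLHS](mul0r (S (cst 1))) -functional_cst//; apply: Sp_ub.
    exact: cst_continuous.
  by split; [exact: cst_continuous|move=> x; rewrite lexx].
apply/eqP; rewrite eq_le half// andbT.
have af0 x : 0 <= (a *: f) x by rewrite mulr_ge0// ltW.
have := @half a^-1 (a *: f) (fcontinuousZ cf) af0.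
rewrite scalerA mulVf ?gt_eqF// scale1r invr_gt0 => /(_ a0).
by rewrite ler_pdivrMl.
Qed.

Let fp f x := Num.max (f x) 0.
Let fm f x := Num.max (- f x) 0.

Let cfp f : continuous f -> continuous (fp f).
Proof. by move=> cf; apply: continuous_maxr => //; exact: cst_continuous. Qed.

Let cfm f : continuous f -> continuous (fm f).
Proof.
move=> cf; apply: continuous_maxr; last exact: cst_continuous.
by move=> x; apply: cvgN; exact: cf.
Qed.

Let fp0 f x : 0 <= fp f x. Proof. by rewrite le_max lexx orbT. Qed.
Let fm0 f x : 0 <= fm f x. Proof. by rewrite le_max lexx orbT. Qed.

Let fpm f x : fp f x - fm f x = f x.
Proof. by rewrite /fp /fm; case: leP => h1; case: leP => h2; lra. Qed.

Let P f := Sp (fp f) - Sp (fm f).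

(** Additivity of [Sp] makes [P] independent of the chosen difference of nonnegative functions, so
    linearity can be checked on any convenient one. *)
Let P_diff f (u v : X -> R) : continuous u -> continuous v -> (forall x, 0 <= u x) ->
  (forall x, 0 <= v x) -> continuous f -> f = u - v -> P f = Sp u - Sp v.
Proof.
move=> cu cv u0 v0 cf fuv.
have : Sp (fp f + v) = Sp (u + fm f).
  congr Sp; apply/funext => x; change (fp f x + v x = u x + fm f x).
  have := fpm f x; have : f x = u x - v x by rewrite fuv.
  lra.
rewrite !SpD//; [|exact: cfm|exact: cfp].
by rewrite /P; lra.
Qed.

Let Sp0 : Sp (cst 0) = 0.
Proof.
have -> : cst 0 = 0 *: cst 0 :> (X -> R) by rewrite scale0r.
by rewrite SpZ ?mul0r//; exact: cst_continuous.
Qed.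

Let P_nonneg f : continuous f -> (forall x, 0 <= f x) -> P f = Sp f.
Proof.
move=> cf f0; rewrite (@P_diff f f (cst 0)) ?Sp0 ?subr0//.
exact: cst_continuous.
Qed.

Let fE f : f = fp f - fm f.
Proof. by apply/funext => x; rewrite -[LHS]fpm. Qed.

Let P_D f g : continuous f -> continuous g -> P (f + g) = P f + P g.
Proof.
move=> cf cg; rewrite (@P_diff (f + g) (fp f + fp g) (fm f + fm g)).
- by rewrite !SpD//; [rewrite /P; ring|exact: cfm|exact: cfm|exact: cfp|exact: cfp].
- by apply: fcontinuousD; exact: cfp.
- by apply: fcontinuousD; exact: cfm.
- by move=> x; rewrite addr_ge0.
- by move=> x; rewrite addr_ge0.
- exact: fcontinuousD.
- by rewrite {1}[f]fE {1}[g]fE opprD addrACA.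
Qed.

Let P_Z f (a : R) : continuous f -> P (a *: f) = a * P f.
Proof.
move=> cf; have [a0|a0] := leP 0 a.
  rewrite (@P_diff (a *: f) (a *: fp f) (a *: fm f)).
  - by rewrite !SpZ//; [rewrite /P; ring|exact: cfm|exact: cfp].
  - by apply: fcontinuousZ; exact: cfp.
  - by apply: fcontinuousZ; exact: cfm.
  - by move=> x; rewrite mulr_ge0.
  - by move=> x; rewrite mulr_ge0.
  - exact: fcontinuousZ.
  - by rewrite -scalerBr -fE.
have na0 : 0 <= - a by rewrite oppr_ge0 ltW.
rewrite (@P_diff (a *: f) ((- a) *: fm f) ((- a) *: fp f)).
- by rewrite !SpZ//; [rewrite /P; ring|exact: cfp|exact: cfm].
- by apply: fcontinuousZ; exact: cfm.
- by apply: fcontinuousZ; exact: cfp.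
- by move=> x; rewrite mulr_ge0.
- by move=> x; rewrite mulr_ge0.
- exact: fcontinuousZ.
- by rewrite -scalerBr -opprB -fE scalerN scaleNr opprK.
Qed.

(** Invariance is the delicate clause, as [tau] may fail to be invertible: composing competitors
    with [tau] gives only [Sp f <= Sp (f \o tau)]. The converse is the same inequality for the
    maximum of [f] minus [f], constants being fixed by composition. *)
Lemma positive_part_functional : compact [set: X] -> X -> exists P,
  [/\ linear_functional P, positive_functional P,
    forall f : X -> R, continuous f -> (forall x, 0 <= f x) -> S f <= P f,
    forall B, linear_functional B -> positive_functional B ->
      (forall f : X -> R, continuous f -> (forall x, 0 <= f x) -> S f <= B f) ->
      forall f : X -> R, continuous f -> (forall x, 0 <= f x) -> P f <= B f &
    forall tau : X -> X, continuous tau ->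
      (forall f : X -> R, continuous f -> S (f \o tau) = S f) ->
      forall f : X -> R, continuous f -> P (f \o tau) = P f].
Proof.
move=> cX x0; have below_id f : continuous f -> (forall x, 0 <= f x) -> below f f.
  by move=> cf f0; split=> // x; rewrite f0 lexx.
exists P; split.
- move=> s t f g cf cg.
  by rewrite P_D ?P_Z//; exact: fcontinuousZ.
- move=> f cf f0; rewrite P_nonneg//.
  have -> : 0 = S (cst 0) by rewrite functional_cst// mul0r.
  by apply: Sp_ub => //; exact: below0.
- by move=> f cf f0; rewrite P_nonneg//; apply: Sp_ub => //; exact: below_id.
- move=> B lB pB SB f cf f0; rewrite P_nonneg//; apply: Sp_le => // g.
  exact: below_ub.
move=> tau ctau Stau.
have ccomp f : continuous f -> continuous (f \o tau).
  by move=> cf x; apply: continuous_comp; [exact: ctau|exact: cf].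
have half f : continuous f -> (forall x, 0 <= f x) -> Sp f <= Sp (f \o tau).
  move=> cf f0; apply: Sp_le => // g [cg gf]; rewrite -Stau//.
  by apply: Sp_ub; [exact: ccomp|split; [exact: ccomp|move=> x; exact: gf]].
have eqn f : continuous f -> (forall x, 0 <= f x) -> Sp (f \o tau) = Sp f.
  move=> cf f0.
  have [x _ xmax] := usc_compact_attains cX (ex_intro [set: X] x0 Logic.I)
    (continuous_usc cf).
  pose g := cst (f x) - f.
  have cc : continuous (cst (f x) : X -> R) by exact: cst_continuous.
  have cg : continuous g by exact: fcontinuousB.
  have g0 y : 0 <= g y by rewrite subr_ge0 xmax.
  have E1 : Sp (cst (f x)) = Sp f + Sp g.
    by rewrite -SpD//; congr Sp; rewrite addrC subrK.
  have E2 : Sp (cst (f x)) = Sp (f \o tau) + Sp (g \o tau).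
    rewrite -SpD; [|exact: ccomp|exact: ccomp|by move=> y; exact: f0|by move=> y; exact: g0].
    congr Sp; apply/funext => y.
    by change (f x = f (tau y) + (f x - f (tau y))); ring.
  have h1 := half f cf f0; have h2 := half g cg g0.
  by apply/eqP; rewrite eq_le h1 andbT; lra.
move=> f cf.
rewrite (@P_diff (f \o tau) (fp f \o tau) (fm f \o tau)).
- by rewrite !eqn//; [exact: cfm|exact: cfp].
- exact/ccomp/cfp.
- exact/ccomp/cfm.
- by move=> x; exact: fp0.
- by move=> x; exact: fm0.
- exact: ccomp.
- by apply/funext => x; rewrite -[LHS]fpm.
Qed.

End positive_part.

(** * The weak-star topology and invariant measures *)

Lemma initial_cvg (S : choiceType) (U : topologicalType) (u : S -> U)
    (F : set_system S) (s : S) : Filter F -> u x @[x --> F] --> u s ->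
  F --> (s : initial_topology u).
Proof.
move=> FF uF W; rewrite nbhsE => -[B [[A oA <-] As] BW].
by apply: filterS BW _; apply: uF; exact: open_nbhs_nbhs.
Qed.

Lemma continuous_borel_measurable (R : realType) (X : pointedMetricType R)
    (tau : X -> X) : continuous tau ->
  measurable_fun [set: g_sigma_algebraType (@open X)]
    (tau : g_sigma_algebraType (@open X) -> g_sigma_algebraType (@open X)).
Proof.
move=> ctau.
apply: (measurability (@open X : set (set (g_sigma_algebraType (@open X)))) erefl).
move=> _ [U oU <-]; rewrite setTI; apply: open_measurable_borel.
by move/continuousP : ctau; apply.
Qed.

Section weak_star.
Context {R : realType} {X : pointedMetricType R}.
Implicit Types (p q : borel_probability X) (f : X -> R).

Definition state p f : R := \int[p]_x f x.

Lemma state_continuous f : continuous f ->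
  continuous (fun p : borel_probability X => state p f).
Proof.
move=> cf; pose phi : continuousType X R := HB.pack f (isContinuous.Build X R f cf).
have cI : continuous (@integral_functional R X) by exact: initial_continuous.
move=> p; apply: (@continuous_comp _ _ _ (@integral_functional R X) (fun u => u phi)).
  exact: cI.
exact: proj_continuous.
Qed.

Lemma state_cvg (F : set_system (borel_probability X)) p : Filter F ->
  (forall f, continuous f -> state q f @[q --> F] --> state p f) -> F --> p.
Proof.
move=> FF cvgF; apply: initial_cvg; apply/cvg_sup => phi.
by apply: initial_cvg; apply: cvgF; exact: cts_fun.
Qed.

Context {G : topologicalSemigroupType} (T : G -> X -> X).

Lemma meas_continuous : continuous (@meas R X G T).
Proof. exact: initial_continuous. Qed.

Lemma invariant_state_cvg (F : set_system (invariant_measure T)) mu : Filter F ->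
  (forall f, continuous f ->
    state (meas nu) f @[nu --> F] --> state (meas mu) f) -> F --> mu.
Proof.
by move=> FF cvgF; apply: initial_cvg; apply: state_cvg => f cf; exact: cvgF.
Qed.

Lemma same_state_closed (C : set (invariant_measure T)) mu nu : closed C ->
  same_state (fun mu => state (meas mu)) mu nu -> C nu -> C mu.
Proof.
move=> cC E Cnu; apply: cC => W Wmu; exists nu; split=> //.
suff : globally [set nu] --> mu by move=> /(_ _ Wmu); apply.
apply: invariant_state_cvg => f cf; apply: cvg_near_cst.
by move=> _ /= ->; rewrite (E f cf).
Qed.

Hypothesis cX : compact [set: X].
Hypothesis cT : continuous_action T.

Lemma invariant_stateP p : Defs.invariant T p <->
  forall g f, continuous f -> state p (f \o T g) = state p f.
Proof.
have cTg g : continuous (T g) by have [] := cT.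
have mT g : measurable_fun [set: g_sigma_algebraType (@open X)]
    (T g : g_sigma_algebraType (@open X) -> g_sigma_algebraType (@open X)).
  exact: continuous_borel_measurable.
pose BX := g_sigma_algebraType (@open X); pose Tm g : BX -> BX := T g.
have ccomp g f : continuous f -> continuous (f \o T g).
  by move=> cf x; apply: continuous_comp; [exact: cTg|exact: cf].
have [D [cD D0 Dsep]] := countable_determining_family cX.
have transfer g (f : X -> R) : continuous f -> (forall x, 0 <= f x) ->
    (\int[pushforward (p : {measure set _ -> \bar R}) (Tm g)]_x (f x)%:E =
    (state p (f \o T g))%:E)%E.
  move=> cf f0; rewrite ge0_integral_pushforward//.
  - by rewrite -integral_EFin//; exact: ccomp.
  - by apply/measurable_EFinP; exact: continuous_measurable_borel.
  - by move=> x _; rewrite lee_fin f0.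
split=> inv.
  move=> g f cf; have [b b0 fb] := compact_continuous_norm_bounded cX cf.
  have cc : continuous (cst b : X -> R) by exact: cst_continuous.
  have cfb : continuous (1 *: f + 1 *: cst b) by apply: fcontinuousD; exact: fcontinuousZ.
  have : (state p ((1 *: f + 1 *: cst b) \o T g))%:E =
      (state p (1 *: f + 1 *: cst b))%:E.
    rewrite -transfer//; last first.
      move=> x; change (0 <= 1 * f x + 1 * b); have := fb x.
      by rewrite ler_norml => /andP[]; lra.
    rewrite -integral_EFin//; apply: eq_measure_integral => A mA _.
    exact: inv.
  move=> [] E; have E2 : state p (1 *: (f \o T g) + 1 *: cst b) = state p (1 *: f + 1 *: cst b).
    exact: E.
  move: E2; rewrite /state !(state_lin cX)//; last exact: ccomp.
  by rewrite !mul1r => /addIr.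
move=> g A mA.
have := Dsep (pushforward (p : {measure set _ -> \bar R}) (Tm g)) p _ _ A mA.
apply => [|i].
  by change (p setT < +oo)%E; rewrite probability_setT ltry.
by rewrite transfer// integral_EFin// inv.
Qed.

Lemma state_functional p : linear_functional (state p) /\ positive_functional (state p).
Proof.
split; first by move=> s t f g cf cg; exact: state_lin.
move=> f cf f0; rewrite -(state_cst p 0); apply: state_le => //.
exact: cst_continuous.
Qed.

(** The integrals of one [f] stay in a compact interval, so they converge along an ultrafilter; the
    limit is positive of mass 1, and Riesz representation makes it a measure. Compactness of the
    spaces of measures follows. *)
Lemma ultra_state_limit (Z : Type) (F : set_system Z) (J : Z -> borel_probability X) :
  UltraFilter F ->
  exists p, forall f : X -> R, continuous f -> state (J z) f @[z --> F] --> state p f.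
Proof.
move=> UF; have PF : ProperFilter F by exact: ultra_proper.
pose L (f : X -> R) : R := lim (state (J z) f @[z --> F]).
have cvgL (f : X -> R) : continuous f -> state (J z) f @[z --> F] --> L f.
  move=> cf; have [b b0 fb] := compact_continuous_norm_bounded cX cf.
  have bd : F ((fun z => state (J z) f) @^-1` `[- b, b]%classic).
    apply: filterE => z; rewrite /= in_itv/=.
    have cc c : continuous (cst c : X -> R) by exact: cst_continuous.
    apply/andP; split.
      rewrite -[leLHS](state_cst (J z) (- b)); apply: state_le => // x.
      by have := fb x; rewrite ler_norml => /andP[].
    rewrite -[leRHS](state_cst (J z) b); apply: state_le => // x.
    by have := fb x; rewrite ler_norml => /andP[].
  have [l [_ lP]] := @segment_compact R (- b) b (state (J z) f @[z --> F]) _ bd.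
  apply/cvg_ex; exists l => W Wl.
  have [//|nW] := in_ultra_setVsetC ((fun z => state (J z) f) @^-1` W) UF.
  by have [r []] := lP (~` W) W nW Wl.
have lL : linear_functional L.
  move=> s t f g cf cg; apply/cvg_lim => //.
  have -> : (fun z => state (J z) (s *: f + t *: g)) =
      (fun z => s * state (J z) f + t * state (J z) g).
    by apply/funext => z; exact: state_lin.
  by apply: cvgD; apply: cvgM; (try exact: cvg_cst); exact: cvgL.
have pL : positive_functional L.
  move=> f cf f0; apply: limr_ge; first by apply/cvg_ex; exists (L f); exact: cvgL.
  by apply: nearW => z; apply: (state_functional (J z)).2.
have L1 : L (cst 1) = 1.
  apply/cvg_lim => //.
  have -> : (fun z => state (J z) (cst 1)) = cst 1.
    by apply/funext => z; exact: state_cst.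
  exact: cvg_cst.
have [p pE] := riesz_representation cX lL pL L1.
by exists p => f cf; rewrite /state pE//; exact: cvgL.
Qed.

Lemma borel_probability_compact : compact [set: borel_probability X].
Proof.
rewrite compact_ultra => F UF _.
have [p pP] := ultra_state_limit id UF.
by exists p; split=> //; exact: state_cvg.
Qed.

Lemma invariant_representation (L : (X -> R) -> R) :
  linear_functional L -> positive_functional L -> L (cst 1) = 1 ->
  (forall g (f : X -> R), continuous f -> L (f \o T g) = L f) ->
  exists mu : invariant_measure T, forall f : X -> R, continuous f ->
    state (meas mu) f = L f.
Proof.
move=> lL pL L1 invL; have [p pE] := riesz_representation cX lL pL L1.
have cTg g : continuous (T g) by have [] := cT.
have invp : [set p | Defs.invariant T p] p.
  apply/invariant_stateP => g f cf; rewrite /state !pE ?invL// => x.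
  by apply: continuous_comp; [exact: cTg|exact: cf].
by exists (exist _ p (mem_set invp)) => f cf; exact: pE.
Qed.

Lemma invariant_measure_compact : compact [set: invariant_measure T].
Proof.
rewrite compact_ultra => F UF _.
have PF : ProperFilter F by exact: ultra_proper.
have [p pP] := ultra_state_limit (@meas R X G T) UF.
have cTg g : continuous (T g) by have [] := cT.
have ccomp g f : continuous f -> continuous (f \o T g).
  by move=> cf x; apply: continuous_comp; [exact: cTg|exact: cf].
have invp : [set p | Defs.invariant T p] p.
  apply/invariant_stateP => g f cf.
  have := pP f cf; have := pP _ (ccomp g f cf).
  have -> : (fun mu : invariant_measure T => state (meas mu) (f \o T g)) =
      (fun mu => state (meas mu) f).
    apply/funext => mu; apply: (invariant_stateP (meas mu)).1 => //.
    exact: set_valP.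
  exact: cvg_unique.
exists (exist _ p (mem_set invp)); split=> //.
by apply: invariant_state_cvg => f cf; exact: pP.
Qed.

(** Normalise by the mass [L (cst 1)]; when this is 0 the functional vanishes and the given
    invariant measure serves as a default. *)
Lemma invariant_cone_representation (L : (X -> R) -> R) :
  invariant_measure T ->
  linear_functional L -> positive_functional L ->
  (forall g (f : X -> R), continuous f -> L (f \o T g) = L f) ->
  exists mu : invariant_measure T, forall f : X -> R, continuous f ->
    L f = L (cst 1) * state (meas mu) f.
Proof.
move=> mu0 lL pL invL; have c1 : continuous (cst 1 : X -> R) by exact: cst_continuous.
have [L0|Ln0] := eqVneq (L (cst 1)) 0.
  exists mu0 => f cf; rewrite L0 mul0r.
  have [b b0 fb] := compact_continuous_norm_bounded cX cf.
  have cc c : continuous (cst c : X -> R) by exact: cst_continuous.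
  apply/eqP; rewrite eq_le; apply/andP; split.
    have := @functional_le _ _ L f (cst b) lL pL cf (cc b).
    rewrite (functional_cst b lL) L0 mulr0; apply => x.
    by have := fb x; rewrite ler_norml => /andP[].
  have := @functional_le _ _ L (cst (- b)) f lL pL (cc _) cf.
  rewrite (functional_cst (- b) lL) L0 mulr0; apply => x.
  by have := fb x; rewrite ler_norml => /andP[].
have L1 : 0 < L (cst 1) by rewrite lt0r Ln0/=; apply: pL.
pose N f := (L (cst 1))^-1 * L f.
have [||||mu muP] := @invariant_representation N.
- by move=> s t f g cf cg; rewrite /N lL//; ring.
- by move=> f cf f0; rewrite /N mulr_ge0 ?invr_ge0 ?(ltW L1)// pL.
- by rewrite /N mulVf.
- by move=> g f cf; rewrite /N invL.
- by exists mu => f cf; rewrite muP// /N mulVKf.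
Qed.

End weak_star.

(** * Invariant measures dominated by an ergodic one *)

Section density.
Context d (Y : measurableType d) (R : realType).
Variables (m n : probability Y R) (T : Type) (tau : T -> Y -> Y).
Hypothesis mtau : forall g, measurable_fun setT (tau g).
Hypothesis m_inv : forall g A, measurable A -> m (tau g @^-1` A) = m A.
Hypothesis n_inv : forall g A, measurable A -> n (tau g @^-1` A) = n A.
Hypothesis nm : n `<< m.
Hypothesis m_erg : forall A, measurable A ->
  (forall g, m ((tau g @^-1` A `\` A) `|` (A `\` tau g @^-1` A)) = 0%E) ->
  m A = 0%E \/ m A = 1%E.

(* With [f] the density of [n], the set [{f > 1}] is almost invariant: [n - m]
   is positive on each of its non-negligible subsets and nonpositive off it. *)
Lemma ergodic_dominated_eq A : measurable A -> n A = m A.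
Proof.
have [f [f0 ffin fint nE']] := radon_nikodym_sigma_finite nm.
have nE B : measurable B -> n B = (\int[m]_(x in B) f x)%E by exact: nE'.
have mf : measurable_fun setT f by exact: measurable_int fint.
pose S := [set x | (1 < f x)%E].
have mS : measurable S.
  rewrite -[S]setTI; exact: emeasurable_fun_o_infty.
have cstE B : measurable B -> (\int[m]_(x in B) 1 = m B)%E.
  by move=> mB; rewrite integral_cst// mul1e.
have mfB B : measurable_fun B f by exact: measurable_funS mf.
have upS B : measurable B -> B `<=` S -> (m B <= n B)%E.
  move=> mB BS; rewrite nE// -cstE//; apply: ge0_le_integral => //.
  by move=> x /BS/ltW.
have downS B : measurable B -> B `<=` ~` S -> (n B <= m B)%E.
  move=> mB BS; rewrite nE// -cstE//; apply: ge0_le_integral => //.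
  by move=> x /BS /negP; rewrite -leNgt.
have strict B : measurable B -> B `<=` S -> n B = m B -> m B = 0%E.
  move=> mB BS nmB.
  have fB : m.-integrable B f by exact: integrableS fint.
  have oneB : m.-integrable B (cst 1%E).
    by apply: (@integrableS _ _ _ _ setT) => //; exact: finite_measure_integrable_cst.
  have : (\int[m]_(x in B) `|f x - 1| = 0)%E.
    rewrite (eq_integral (fun x => f x - 1)%E); last first.
      move=> x /set_mem/BS/ltW f1; rewrite gee0_abs// sube_ge0//.
    by rewrite integralB//= -nE// cstE// nmB subee// fin_num_measure.
  have mf1 : measurable_fun B (fun x => f x - 1)%E.
    by apply: emeasurable_funB => //; exact: measurable_cst.
  move=> /(ae_eq_integral_abs m mB mf1) ae0; apply: measure_negligible => //.
  apply: negligibleS ae0 => x Bx /(_ Bx) /eqP.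
  by rewrite sube_eq ?ffin// add0e => /eqP fx; have := BS _ Bx; rewrite /S/= fx ltxx.
have mpre g : measurable (tau g @^-1` S).
  by rewrite -[X in measurable X]setTI; exact: mtau.
have nfin B : measurable B -> n B = (fine (n B))%:E.
  by move=> mB; rewrite fineK// fin_num_measure.
have mfin B : measurable B -> m B = (fine (m B))%:E.
  by move=> mB; rewrite fineK// fin_num_measure.
have split_fine (p : probability Y R) B C : measurable B -> measurable C ->
    fine (p B) = fine (p (B `\` C)) + fine (p (B `&` C)).
  move=> mB mC; rewrite [in LHS](measureDI p mB mC) fineD// fin_num_measure//.
    exact: measurableD.
  exact: measurableI.
have S_inv g : m ((tau g @^-1` S `\` S) `|` (S `\` tau g @^-1` S)) = 0%E.
  have mD1 : measurable (S `\` tau g @^-1` S) by exact: measurableD.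
  have mD2 : measurable (tau g @^-1` S `\` S) by exact: measurableD.
  have eqD (p : probability Y R) : p (tau g @^-1` S) = p S ->
      fine (p (S `\` tau g @^-1` S)) = fine (p (tau g @^-1` S `\` S)).
    move=> pS; have := split_fine p S (tau g @^-1` S) mS (mpre g).
    have := split_fine p (tau g @^-1` S) S (mpre g) mS.
    by rewrite pS [_ `&` S]setIC; lra.
  have eqn := eqD n (n_inv g mS); have eqm := eqD m (m_inv g mS).
  have := upS _ mD1 (@subDsetl _ _ _).
  have := downS _ mD2 (@subIsetr _ _ _).
  rewrite (nfin _ mD1) (nfin _ mD2) (mfin _ mD1) (mfin _ mD2) !lee_fin eqn eqm => h1 h2.
  (* [n] is at least [m] on this difference and at most [m] on the opposite one, while each measure
     gives the two differences equal mass; so [n] and [m] agree here and [strict] applies. *)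
  have D10 : m (S `\` tau g @^-1` S) = 0%E.
    apply: strict => //.
    by rewrite nfin// mfin// eqn eqm; congr EFin; apply/eqP; rewrite eq_le h1.
  have D20 : m (tau g @^-1` S `\` S) = 0%E by rewrite mfin// -eqm D10.
  apply/eqP; rewrite eq_le measure_ge0 andbT.
  have : (m ((tau g @^-1` S `\` S) `|` (S `\` tau g @^-1` S)) <=
      m (tau g @^-1` S `\` S) + m (S `\` tau g @^-1` S))%E by exact: measureU2.
  by rewrite D10 D20 adde0.
have mS0 : m S = 0%E.
  (* If [m S = 1], then [n S >= m S] forces equality of the two masses, and [strict] yields
     [m S = 0] all the same. *)
  have [//|mS1] := m_erg mS S_inv.
  apply: strict => //; apply/eqP; rewrite eq_le upS// mS1 andbT.
  exact: probability_le1.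
have nS0 : n S = 0%E.
  by apply: (nm (iffRL (measure0_null_setP _ mS) mS0)).
have le_nm B : measurable B -> (n B <= m B)%E.
  move=> mB; have -> : (n B = n (B `\` S) + n (B `&` S))%E by exact: measureDI.
  rewrite (_ : n (B `&` S) = 0%E) ?adde0.
    apply: (@le_trans _ _ (m (B `\` S))).
      by apply: downS; [exact: measurableD|move=> x []].
    by apply: le_measure; rewrite ?inE//; exact: measurableD.
  apply/eqP; rewrite eq_le measure_ge0 andbT -nS0.
  by apply: le_measure; rewrite ?inE//; exact: measurableI.
(* Both measures have mass 1, so [n <= m] on the complement gives [m <= n] on [A]. *)
move=> mA; apply/eqP; rewrite eq_le le_nm//=.
have := le_nm _ (measurableC mA); rewrite !probability_setC//.
rewrite (nfin _ mA) (mfin _ mA) -!EFinB !lee_fin; lra.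
Qed.

End density.

(** * The invariant measures form a simplex *)

Section invariant_states.
Context {R : realType} {X : pointedMetricType R}.
Context {G : topologicalSemigroupType} (T : G -> X -> X).
Hypothesis cX : compact [set: X].
Hypothesis cT : continuous_action T.
Local Notation M := (invariant_measure T).
Local Notation I := (fun mu : M => state (meas mu)).
Implicit Types (f : X -> R) (L : (X -> R) -> R).

Let cc (c : R) : continuous (cst c : X -> R).
Proof. exact: cst_continuous. Qed.

Let sl (p : borel_probability X) : linear_functional (state p).
Proof. by have [] := state_functional cX p. Qed.

Let sp (p : borel_probability X) : positive_functional (state p).
Proof. by have [] := state_functional cX p. Qed.

Let s1 (p : borel_probability X) : state p (cst 1) = 1.
Proof. exact: state_cst. Qed.

Let Iinv (mu : M) g f : continuous f -> I mu (f \o T g) = I mu f.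
Proof. by apply: (invariant_stateP cX cT (meas mu)).1; exact: set_valP. Qed.

Lemma dirac_state (a : X) :
  exists p, forall f : X -> R, continuous f -> state p f = f a.
Proof.
have [|||p pE] := riesz_representation (L := fun f => f a) cX.
- by move=> s t f g _ _.
- by move=> f _ f0.
- by [].
- by exists p.
Qed.

Lemma borel_mixture_ex (t : R) (p q : borel_probability X) : 0 <= t <= 1 ->
  exists r, state_mixture state t p q r.
Proof.
move=> /andP[t0 t1].
have [|||r rE] := riesz_representation
  (L := fun f => t * state p f + (1 - t) * state q f) cX.
- by move=> u v f g cf cg; rewrite !sl//; ring.
- by move=> f cf f0; rewrite addr_ge0// mulr_ge0 ?subr_ge0// sp.
- by rewrite !s1; ring.
- by exists r.
Qed.

Lemma invariant_mixture_ex (t : R) (x y : M) : 0 <= t <= 1 ->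
  exists z : M, state_mixture I t x y z.
Proof.
move=> /andP[t0 t1].
have [||||r rE] := invariant_representation cX cT
  (L := fun f => t * I x f + (1 - t) * I y f).
- by move=> u v f g cf cg; rewrite !sl//; ring.
- by move=> f cf f0; rewrite addr_ge0// mulr_ge0 ?subr_ge0// sp.
- by rewrite !s1; ring.
- by move=> g f cf; rewrite !Iinv.
- by exists r.
Qed.

Lemma state_mixtureP (t : R) (x y z : M) : 0 <= t <= 1 ->
  state_mixture I t x y z <-> is_mixture t x y z.
Proof.
move=> /andP[t0 t1]; have t1' : 0 <= 1 - t by rewrite subr_ge0.
pose m := measure_add (mscale (NngNum t0) (meas x : {measure set _ -> \bar R}))
  (mscale (NngNum t1') (meas y : {measure set _ -> \bar R})).
have mE A : m A = (t%:E * meas x A + (1 - t)%:E * meas y A)%E.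
  by rewrite /m measure_addE.
have mI (f : X -> R) : continuous f -> (forall x, 0 <= f x) ->
    (\int[m]_a (f a)%:E = (t * I x f + (1 - t) * I y f)%:E)%E.
  move=> cf f0.
  have mf : measurable_fun [set: g_sigma_algebraType (@open X)]
      (fun a : g_sigma_algebraType (@open X) => (f a)%:E).
    by apply/measurable_EFinP; exact: continuous_measurable_borel.
  rewrite /m ge0_integral_measure_add//; last by move=> a _; rewrite lee_fin.
  rewrite !ge0_integral_mscale//; try by move=> a _; rewrite lee_fin.
  by rewrite !integral_EFin.
split=> [mix A mA|mix f cf].
  have [D [cD D0 Dsep]] := countable_determining_family cX.
  rewrite -mE; apply: (Dsep (meas z) m) => //.
    by change (meas z setT < +oo)%E; rewrite probability_setT ltry.
  by move=> i; rewrite mI// -mix// -integral_EFin.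
have pos (k : X -> R) : continuous k -> (forall x, 0 <= k x) ->
    I z k = t * I x k + (1 - t) * I y k.
  move=> ck k0; apply: EFin_inj; rewrite -mI// -integral_EFin//.
  by apply: eq_measure_integral => A mA _; exact: etrans (mix A mA) (esym (mE A)).
have [b b0 fb] := compact_continuous_norm_bounded cX cf.
have := pos (f + cst b) (fcontinuousD cf (@cc b)).
rewrite !(functionalD (sl _) cf (@cc b)) !(functional_cst b (sl _)) !s1 => h.
suff : forall a, 0 <= (f + cst b) a by move=> /h; lra.
by move=> a; change (0 <= f a + b); have := fb a; rewrite ler_norml => /andP[]; lra.
Qed.

Let difference_functional (a b : R) (p q : borel_probability X) :
  linear_functional (fun f => a * state p f - b * state q f).
Proof. by move=> u v f g cf cg; rewrite !sl//; ring. Qed.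

(** [f \o T g - f] has zero invariant integrals, so the hypothesis makes [p - q] invariant, and its
    positive part with it. That part is dominated by [p], whence mass at most 1; the negative part
    has the same mass because [p] and [q] do. *)
Lemma invariant_jordan (mu0 : M) (p q : borel_probability X) :
  (forall f : X -> R, continuous f -> (forall x : M, I x f = 0) ->
    state p f = state q f) ->
  exists2 m : R, 0 <= m <= 1 & exists x y : M, forall f : X -> R, continuous f ->
    state p f - state q f = m * (I x f - I y f).
Proof.
move=> null; pose S f := state p f - state q f.
have lS : linear_functional S by move=> u v f g cf cg; rewrite /S !sl//; ring.
have Sp f : continuous f -> (forall x, 0 <= f x) -> S f <= state p f.
  by move=> cf f0; rewrite gerBl sp.
have ccomp g f : continuous f -> continuous (f \o T g).
  move=> cf x; apply: continuous_comp; last exact: cf.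
  by have [cTg _] := cT; exact: cTg.
have Sinv g f : continuous f -> S (f \o T g) = S f.
  move=> cf; have cfT := ccomp g f cf.
  have := null (f \o T g - f) (fcontinuousB cfT cf).
  rewrite !(functionalB (sl _) cfT cf) /S => h.
  suff : forall x : M, I x (f \o T g - f) = 0 by move=> /h; lra.
  by move=> x; rewrite (functionalB (sl _) cfT cf) Iinv// subrr.
have [P [lP pP SP Pleast Pinv]] := positive_part_functional lS (sl p) (@sp p) Sp cX point.
have PT g f : continuous f -> P (f \o T g) = P f.
  apply: Pinv; first by have [cTg _] := cT.
  exact: Sinv.
pose N f := P f - S f.
have lN : linear_functional N.
  by move=> u v f g cf cg; rewrite /N lP// lS//; ring.
have pN : positive_functional N by move=> f cf f0; rewrite subr_ge0 SP.
have NT g f : continuous f -> N (f \o T g) = N f.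
  by move=> cf; rewrite /N PT// Sinv.
have [x xE] := invariant_cone_representation cX cT mu0 lP pP PT.
have [y yE] := invariant_cone_representation cX cT mu0 lN pN NT.
exists (P (cst 1)).
  rewrite pP//= -[leRHS](s1 p); apply: (Pleast _ (sl p) (@sp p) Sp) => //.
exists x, y => f cf; rewrite mulrBr -xE//.
have E1 : N (cst 1) = P (cst 1) by rewrite /N /S !s1 subrr subr0.
by rewrite -E1 -yE// /N -/(S f); ring.
Qed.

(** The entry of mass [b] is the positive part of [s x - t x'], the least positive functional above
    it. It is therefore below [s x], and also below [(1 - t) y'], because [s x - t x'] equals
    [(1 - t) y' - (1 - s) y]. Row and column sums impose the other entries. *)
Lemma invariant_refinement (s t : R) (x y x' y' : M) :
  0 <= s <= 1 -> 0 <= t <= 1 ->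
  (forall f : X -> R, continuous f ->
    s * I x f + (1 - s) * I y f = t * I x' f + (1 - t) * I y' f) ->
  exists (a b c d : R) m11 m12 m21 m22,
    [/\ 0 <= a, 0 <= b, 0 <= c & 0 <= d] /\
    [/\ a + b = s, c + d = 1 - s, a + c = t & b + d = 1 - t] /\
    forall f : X -> R, continuous f ->
    [/\ s * I x f = a * I m11 f + b * I m12 f,
        (1 - s) * I y f = c * I m21 f + d * I m22 f,
        t * I x' f = a * I m11 f + c * I m21 f &
        (1 - t) * I y' f = b * I m12 f + d * I m22 f].
Proof.
move=> /andP[s0 s1'] /andP[t0 t1] E.
have s1'' : 0 <= 1 - s by rewrite subr_ge0.
have t1'' : 0 <= 1 - t by rewrite subr_ge0.
have scaled (a : R) (z : M) : 0 <= a -> linear_functional (fun f => a * I z f) /\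
    positive_functional (fun f => a * I z f).
  move=> a0; split; first by move=> u v f g cf cg; rewrite sl//; ring.
  by move=> f cf f0; rewrite mulr_ge0// sp.
have [lx px] := scaled s x s0; have [ly py] := scaled _ y s1''.
have [lx' px'] := scaled t x' t0; have [ly' py'] := scaled _ y' t1''.
pose S f := s * I x f - t * I x' f.
have lS : linear_functional S by exact: difference_functional.
have Sx f : continuous f -> (forall x, 0 <= f x) -> S f <= s * I x f.
  by move=> cf f0; rewrite gerBl px'.
have Sy f : continuous f -> (forall x, 0 <= f x) -> S f <= (1 - t) * I y' f.
  by move=> cf f0; have := E f cf; have := py f cf f0; rewrite /S; lra.
have [P [lP pP SP Pleast Pinv]] := positive_part_functional lS lx px Sx cX point.
have Px := Pleast _ lx px Sx; have Py := Pleast _ ly' py' Sy.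
have inv12 g f : continuous f -> P (f \o T g) = P f.
  apply: Pinv; first by have [cTg _] := cT.
  by move=> k ck; rewrite /S !Iinv.
pose P11 f := s * I x f - P f.
pose P21 f := t * I x' f - P11 f.
pose P22 f := (1 - t) * I y' f - P f.
have l11 : linear_functional P11 by move=> u v f g cf cg; rewrite /P11 lx// lP//; ring.
have l21 : linear_functional P21 by move=> u v f g cf cg; rewrite /P21 lx'// l11//; ring.
have l22 : linear_functional P22 by move=> u v f g cf cg; rewrite /P22 ly'// lP//; ring.
have p11 : positive_functional P11 by move=> f cf f0; rewrite subr_ge0 Px.
have p21 : positive_functional P21.
  by move=> f cf f0; have := SP f cf f0; rewrite /P21 /P11 /S; lra.
have p22 : positive_functional P22 by move=> f cf f0; rewrite subr_ge0 Py.
have i11 g f : continuous f -> P11 (f \o T g) = P11 f.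
  by move=> cf; rewrite /P11 Iinv// inv12.
have i21 g f : continuous f -> P21 (f \o T g) = P21 f.
  by move=> cf; rewrite /P21 Iinv// i11.
have i22 g f : continuous f -> P22 (f \o T g) = P22 f.
  by move=> cf; rewrite /P22 Iinv// inv12.
have [m11 E11] := invariant_cone_representation cX cT x l11 p11 i11.
have [m12 E12] := invariant_cone_representation cX cT x lP pP inv12.
have [m21 E21] := invariant_cone_representation cX cT x l21 p21 i21.
have [m22 E22] := invariant_cone_representation cX cT x l22 p22 i22.
exists (P11 (cst 1)), (P (cst 1)), (P21 (cst 1)), (P22 (cst 1)), m11, m12, m21, m22.
split; first by split; [exact: p11|exact: pP|exact: p21|exact: p22].
split.
  by rewrite /P21 /P22 /P11 !s1; split; ring.
move=> f cf; rewrite -E11// -E12// -E21// -E22//.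
have := E f cf; rewrite /P21 /P22 /P11 => h; split; try ring.
lra.
Qed.

(** A component of a nontrivial mixture is absolutely continuous with respect to [e], so
    [ergodic_dominated_eq] identifies the two. *)
Lemma ergodic_extreme (e : M) : ergodic e -> extreme_state I e.
Proof.
have half (s : R) (x y : M) : ergodic e -> 0 < s < 1 ->
    is_mixture s x y e -> same_state I x e.
  move=> erg /andP[s0 s1'] mix f cf.
  have eqA A : measurable A -> meas x A = meas e A.
    have cTg g : continuous (T g) by have [] := cT.
    apply: (@ergodic_dominated_eq _ (g_sigma_algebraType (@open X)) R (meas e) (meas x) G T).
    - by move=> g; exact: continuous_borel_measurable.
    - by move=> g B; exact: (set_valP e).
    - by move=> g B; exact: (set_valP x).
    - move=> B Bnull C mC CB; have eC : meas e C = 0%E by exact: Bnull.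
      have : (s%:E * meas x C <= meas e C)%E.
        by rewrite (mix C mC) leeDl// mule_ge0// lee_fin subr_ge0 ltW.
      by rewrite eC pmule_rle0 ?lte_fin// measure_le0 => /eqP.
    - exact: erg.
  congr fine; apply: eq_measure_integral => A mA _; exact: eqA.
move=> erg s x y s01 mix.
have /andP[s0 s1'] := s01.
have s01' : 0 <= s <= 1 by rewrite !ltW.
split; first by apply: (half s x y) => //; exact/state_mixtureP.
apply: (half (1 - s) y x) => //; first by apply/andP; split; lra.
apply/state_mixtureP; first by apply/andP; split; lra.
by move=> f cf; rewrite mix//; ring.
Qed.

End invariant_states.

(** * The closed convex hull as a set of equilibrium states *)

Lemma closed_convex_hull_properties (R : realType) (X : pointedMetricType R)
    (G : topologicalSemigroupType) (T : G -> X -> X)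
    (E : set (invariant_measure T)) :
  [/\ closed (closed_convex_hull E), convex_measures (closed_convex_hull E) &
    E `<=` closed_convex_hull E].
Proof.
split.
- by apply: closed_bigI => C [[]].
- move=> t mu nu rho t01 mix Fmu Fnu C CE; have [[cC vC] EC] := CE.
  by apply: vC t01 mix _ _; [exact: Fmu|exact: Fnu].
- by move=> mu Emu C [_]; exact.
Qed.

Theorem corollary3 (R : realType) (X : pointedMetricType R)
    (G : topologicalSemigroupType) (T : G -> X -> X)
    (h : invariant_measure T -> R) (E : set (invariant_measure T)) :
  compact [set: X] ->
  continuous_action T ->
  [set: invariant_measure T] !=set0 ->
  (forall mu, 0 <= h mu) ->
  affine_map h ->
  (topological_entropy h < +oo)%E ->
  upper_semicontinuous h ->
  E !=set0 ->
  (forall mu, E mu -> ergodic mu) ->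
  closed E ->
  (forall mu nu, E mu -> E nu -> h mu = h nu) ->
  exists phi : X -> R, continuous phi /\
    forall beta : R, 1 <= beta ->
      closed_convex_hull E =
        [set mu | equilibrium_state h (fun x => beta * phi x) mu].
Proof.
move=> cX cT _ _ ah _ uh [e0 Ee0] ergE cE hE.
pose I (mu : invariant_measure T) := state (meas mu).
have [cF vF EF] := closed_convex_hull_properties E.
have ahI : state_affine I h.
  by move=> t x y z t01 mix; apply: ah => //; exact/(state_mixtureP cX).
have [D [cD D0 Dsep]] := countable_determining_family cX.
have I_cont (f : X -> R) : continuous f -> continuous (I ^~ f).
  move=> cf mu; apply: (@continuous_comp _ _ _ (@meas R X G T) (state ^~ f)).
    exact: meas_continuous.
  exact: state_continuous.
have [phi [cphi hphi phi0 phiF phinF]] : exists f : X -> R,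
    [/\ continuous f, forall x, h x - h e0 <= I x f, forall x, 0 <= I x f,
    forall x, closed_convex_hull E x -> I x f = 0 &
    forall x, ~ closed_convex_hull E x -> h x - h e0 < I x f].
  apply: (@exposing_function R X _ I (invariant_measure_compact cX cT)
    _ _ _ _ _ _ state _ _ _ _ _ _ _ e0 E _ _ h _ _ _ D) => //.
  - by move=> mu s t f g; exact: state_lin.
  - by move=> mu c; exact: state_cst.
  - by move=> t x y; exact: (invariant_mixture_ex cX cT).
  - by move=> s t x y x' y'; exact: (invariant_refinement cX cT).
  - by move=> mu f g; exact: state_le.
  - exact: borel_probability_compact.
  - by move=> mu s t f g; exact: state_lin.
  - by move=> f; exact: state_continuous.
  - exact: dirac_state.
  - by move=> t p q; exact: borel_mixture_ex.
  - by move=> p q; exact: (invariant_jordan cX cT e0).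
  - by move=> e Ee; apply: (ergodic_extreme cX cT); exact: ergE.
  - by move=> e Ee; exact: hE.
  - by exists e0.
  - by move=> C cC x y; exact: same_state_closed.
  - by move=> t x y z t01 /(state_mixtureP cX _ _ _ t01); exact: vF.
  - move=> C cC vC EC x; apply; split=> //; split=> // t mu nu rho t01.
    by move=> /(state_mixtureP cX _ _ _ t01); exact: vC.
  - move=> x y xy f cf; congr fine; apply: eq_measure_integral => A mA _.
    apply: Dsep => //.
      by change (meas x setT < +oo)%E; rewrite probability_setT ltry.
    by move=> i; rewrite !integral_EFin//; congr EFin; exact: xy.
(* With this sign, [hphi] bounds the pressure by [h e0] when [beta = 1], and the nonnegative
   integrals of [phi] extend the bound to [beta >= 1]. *)
exists (fun x => - phi x); split; first by move=> x; apply: cvgN; exact: cphi.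
move=> beta beta1.
have PE mu : pressure_functional h (fun x => beta * - phi x) mu =
    h mu - beta * I mu phi.
  rewrite /pressure_functional; congr (_ + _).
  rewrite -[RHS]mulNr -(functionalZ (- beta) (state_functional cX (meas mu)).1 cphi).
  by apply: eq_Rintegral => x _; change (beta * - phi x = - beta * phi x); ring.
have P_le mu : h mu - beta * I mu phi <= h e0.
  have := hphi mu; have : I mu phi <= beta * I mu phi by rewrite ler_peMl.
  lra.
have P_e0 : h e0 - beta * I e0 phi = h e0.
  by rewrite phiF ?mulr0 ?subr0//; exact: EF.
have pressE : pressure h (fun x => beta * - phi x) = (h e0)%:E.
  apply/eqP; rewrite eq_le; apply/andP; split.
    by apply: ge_ereal_sup => _ [mu _ <-]; rewrite lee_fin PE.
  by apply: ereal_sup_ubound; exists e0 => //; rewrite PE P_e0.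
apply/seteqP; split=> mu; rewrite /equilibrium_state /= pressE PE.
  move=> Fmu; rewrite phiF// mulr0 subr0; congr EFin.
  (* Semicontinuity makes this superlevel set closed and affinity makes it convex. On the hull
     [hphi] gives the opposite bound, as the integral of [phi] vanishes there. *)
  have h_ge : closed_convex_hull E `<=` [set nu | h e0 <= h nu].
    move=> nu; apply; split; last by move=> e Ee /=; rewrite (hE e0 e).
    split.
      rewrite -[X in closed X]setCK; apply: open_closedC; rewrite openE => x /= /negP.
      rewrite -ltNge => hx; apply: filterS (uh _ _ hx) => y hy /=.
      by apply/negP; rewrite -ltNge.
    move=> t x y z /[dup] t01 /andP[t0 t1] mix /= hx hy; rewrite (ah _ _ _ _ t01 mix).
    have : t * h e0 <= t * h x by rewrite ler_wpM2l.
    have : (1 - t) * h e0 <= (1 - t) * h y by rewrite ler_wpM2l// subr_ge0.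
    lra.
  apply/eqP; rewrite eq_le h_ge//=.
  by have := hphi mu; rewrite phiF//; lra.
(* Outside the hull the bound is strict, and [beta >= 1] can only widen the gap. *)
move=> [] eqP; apply: contrapT => nF; have := phinF _ nF.
have : I mu phi <= beta * I mu phi by rewrite ler_peMl.
lra.
Qed.
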